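(* Let $\tau$ be a preorder on an $n$-element set $E$ and let $\tau^\ast$ be its dual preorder. (a) The Ehrhart polynomial of $\mathcal{Q}_\tau$ is given by \[ \mathrm{Ehr}(\mathcal{Q}_\tau,t)=\sum_{(a_e)\in P_{\tau^\ast}}\prod_{e\in E}\binom{t+a_e-1}{a_e}, \] where the sum ranges over all lattice points $(a_e)_{e\in E}$ of $\mathcal{Q}_{\tau^\ast}$. In particular, the number of lattice points of $\mathcal{Q}_\tau$ equals that of $\mathcal{Q}_{\tau^\ast}$. Moreover, the normalized volume of $\mathcal{Q}_\tau$ equals the number of words $w\in E^n$ such that for every order ideal $\mathcal{I}$ of $\tau$, the elements of $\mathcal{I}$ appear a total of at least $|\mathcal{I}|$ times in $w$. (b) $\mathrm{Ehr}(\mathcal{Q}_\tau,t)=\mathcal{Z}(P_{\tau^\ast},t+1)$.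
   Context: A preorder on a finite set $E$ is a reflexive and transitive relation $\le$ on $E$; its dual $\tau^\ast$ is the preorder with $a\le^\ast b$ iff $b\le a$. An order ideal of $\tau$ is a subset $\mathcal{I}\subseteq E$ such that $b\in\mathcal{I}$ and $a\le b$ imply $a\in\mathcal{I}$. The preorder polytope $\mathcal{Q}_\tau\subset\mathbb{R}^E$ is defined by $x_e\ge0$ for $e\in E$ and $\sum_{e\in\mathcal{I}}x_e\le|\mathcal{I}|$ for every order ideal $\mathcal{I}$ of $\tau$. $P_\tau$ denotes the set of lattice points of $\mathcal{Q}_\tau$, partially ordered componentwise ($\mathbf{a}\preceq\mathbf{b}$ iff $a_e\le b_e$ for all $e$). The Ehrhart polynomial $\mathrm{Ehr}(\mathcal{Q},t)$ of a lattice polytope $\mathcal{Q}$ is the polynomial with $\mathrm{Ehr}(\mathcal{Q},m)=\#(m\mathcal{Q}\cap\mathbb{Z}^E)$ for all $m\in\mathbb{N}$; the normalized volume of an $n$-dimensional lattice polytope is $n!$ times its volume. The zeta polynomial $\mathcal{Z}(P,t)$ of a finite poset $P$ is the polynomial such that $\mathcal{Z}(P,m+1)$ equals the number of multichains $p_1\preceq p_2\preceq\cdots\preceq p_m$ in $P$, for every $m\in\mathbb{N}$. *)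

(* Defs.v *)
From HB Require Import structures.
From mathcomp Require Export all_boot all_order all_algebra finmap.
From mathcomp Require Export all_classical all_reals all_analysis.
From mathcomp Require Import measurable_realfun.

Set Implicit Arguments.
Unset Strict Implicit.
Unset Printing Implicit Defensive.
Import Order.TTheory GRing.Theory Num.Theory.
Local Open Scope classical_set_scope.
Local Open Scope ring_scope.

(* Junk value 0 when A is infinite. *)
Definition ncard (T : choiceType) (A : set T) : nat := #|` fset_set A|%fset.

Section Volume.
Variable R : realType.

(* Lebesgue measure on R^n, as the n-fold product of the one-dimensional
   Lebesgue measure, transported along R * R^n ~ R^(n+1). *)
Fixpoint lebesgue_tuple (n : nat) : set (n.-tuple R) -> \bar R :=
  match n with
  | 0 => \d_ [tuple]
  | k.+1 => pushforward (lebesgue_measure \x (@lebesgue_tuple k))%E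
              (fun p => [tuple of p.1 :: p.2])
  end.

Definition volume (E : finType) (A : set {ffun E -> R}) : \bar R :=
  @lebesgue_tuple #|E|
    ((fun t : #|E|.-tuple R => [ffun e => tnth t (enum_rank e)]) @^-1` A).

Definition normalized_volume (E : finType) (A : set {ffun E -> R}) : \bar R :=
  (((#|E|)`!%:R)%:E * volume A)%E.

Lemma lebesgue_tuple0 n : @lebesgue_tuple n set0 = 0%E.
Proof.
elim: n => [|n IH] /=; first by rewrite diracE in_set0.
rewrite /pushforward preimage_set0 /product_measure1.
by rewrite integral0_eq// => x _ /=; rewrite xsection0.
Qed.

Lemma lebesgue_tuple_box n (a b : 'I_n -> R) : (forall i, a i <= b i) ->
  @lebesgue_tuple n [set t | forall i, a i <= tnth t i <= b i]
  = (\prod_(i < n) (b i - a i))%:E.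
Proof.
elim: n a b => [|n IH] a b ab.
  by rewrite big_ord0 /= diracE mem_set// => -[].
rewrite /= /pushforward /product_measure1 big_ord_recl EFinM.
under eq_integral => x _.
  rewrite /= (_ : lebesgue_tuple _ =
    (\1_(`[a ord0, b ord0]) x)%:E
      * (\prod_(i < n) (b (lift ord0 i) - a (lift ord0 i)))%:E)%E.
    over.
  rewrite -IH// indicE.
  have [/set_mem/= xab|/negP xab] := boolP (x \in _).
    rewrite mul1e; congr lebesgue_tuple; apply/seteqP; split => t /=.
      rewrite /xsection /= inE /= => h i.
      by have := h (lift ord0 i); rewrite tnthS.
    rewrite /xsection /= inE /= => h i.
    have [j ->|->] := unliftP ord0 i; first by rewrite tnthS.
    by rewrite tnth0; move: xab; rewrite in_itv.
  rewrite mul0e -[RHS](lebesgue_tuple0 n); congr lebesgue_tuple.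
  apply/seteqP; split => t //=; rewrite /xsection /= inE /= => h.
  by apply: xab; rewrite inE /= in_itv; have := h ord0; rewrite tnth0.
rewrite ge0_integralZr//=; last 2 first.
- exact/measurable_EFinP/measurable_indic.
- by rewrite lee_fin prodr_ge0// => i _; rewrite subr_ge0.
rewrite integral_indic// setIT /= lebesgue_measure_itv /=.
case: ifPn => [//|]; rewrite lte_fin -leNgt => ba.
by rewrite (_ : b ord0 = a ord0) ?subrr//; apply/eqP; rewrite eq_le ba ab.
Qed.

End Volume.

Section LatticePoints.
Variables (R : realType) (E : finType).

Definition dilate (m : R) (A : set {ffun E -> R}) : set {ffun E -> R} :=
  [set [ffun e => m * x e] | x in A].

Definition lattice_points (A : set {ffun E -> R}) : set {ffun E -> int} :=
  [set a | A [ffun e => (a e)%:~R]].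

Definition is_ehrhart_poly (A : set {ffun E -> R}) (p : {poly rat}) : Prop :=
  forall m : nat, p.[m%:R] = (ncard (lattice_points (dilate m%:R A)))%:R.

(* Junk value 0 when no such polynomial exists; likewise for zeta_poly. *)
Definition ehrhart_poly (A : set {ffun E -> R}) : {poly rat} :=
  xget 0 [set p | is_ehrhart_poly A p].

End LatticePoints.

Section Zeta.
Variables (T : choiceType) (le : rel T).

Definition multichains (P : set T) (m : nat) : set (m.-tuple T) :=
  [set p | (forall i, P (tnth p i)) /\ sorted le p].

Definition is_zeta_poly (P : set T) (p : {poly rat}) : Prop :=
  forall m : nat, p.[m.+1%:R] = (ncard (@multichains P m))%:R.

Definition zeta_poly (P : set T) : {poly rat} :=
  xget 0 [set p | is_zeta_poly P p].

End Zeta.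

Arguments multichains {T} le P m.

(* binom(p, k) = p (p - 1) ... (p - k + 1) / k! *)
Definition binomp (p : {poly rat}) (k : nat) : {poly rat} :=
  ((k`!)%:R)^-1 *: \prod_(i < k) (p - i%:R).

Section Preorder.
Variables (R : realType) (E : finType).
Implicit Type tau : rel E.

Definition dual_rel tau : rel E := fun a b => tau b a.

Definition order_ideal tau (I : {set E}) : bool :=
  [forall a, forall b, (b \in I) && tau a b ==> (a \in I)].

Definition preorder_polytope tau : set {ffun E -> R} :=
  [set x | (forall e, 0 <= x e) /\
           forall I : {set E}, order_ideal tau I ->
             \sum_(e in I) x e <= #|I|%:R].

Definition preorder_points tau : set {ffun E -> int} :=
  lattice_points (preorder_polytope tau).

Definition cw_le : rel {ffun E -> int} := fun a b => [forall e, a e <= b e].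

Definition ideal_word tau (n : nat) : pred (n.-tuple E) :=
  fun w => [forall I : {set E},
              order_ideal tau I ==> (#|I| <= count [in I] w)%N].

End Preorder.

Arguments preorder_polytope R {E} tau.
Arguments preorder_points R {E} tau.
Arguments cw_le {E}.
Arguments ideal_word {E} tau n.

Lemma horner_nat_inj (p q : {poly rat}) (k : nat) :
  (forall m : nat, p.[(m + k)%:R] = q.[(m + k)%:R]) -> p = q.
Proof.
move=> pq; apply/eqP; rewrite -subr_eq0; apply/negPn/negP => d0.
pose s := [seq (m + k)%:R : rat | m <- iota 0 (size (p - q))].
have s_root : all (root (p - q)) s.
  by apply/allP => _ /mapP[m _ ->]; rewrite rootE !hornerE pq subrr.
have s_uniq : uniq s.
  rewrite map_inj_uniq ?iota_uniq// => i j /eqP.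
  by rewrite eqr_nat eqn_add2r => /eqP.
by have := max_poly_roots d0 s_root s_uniq; rewrite size_map size_iota ltnn.
Qed.

Lemma is_ehrhart_poly_unique (R : realType) (E : finType)
    (A : set {ffun E -> R}) (p q : {poly rat}) :
  is_ehrhart_poly A p -> is_ehrhart_poly A q -> p = q.
Proof.
by move=> hp hq; apply: (@horner_nat_inj _ _ 0) => m; rewrite addn0 hp hq.
Qed.

Lemma is_zeta_poly_unique (T : choiceType) (le : rel T) (P : set T)
    (p q : {poly rat}) :
  is_zeta_poly le P p -> is_zeta_poly le P q -> p = q.
Proof.
by move=> hp hq; apply: (@horner_nat_inj _ _ 1) => m; rewrite addn1 hp hq.
Qed.

Lemma finite_dilate_polytope (R : realType) (E : finType) (tau : rel E)
    (m : nat) :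
  finite_set (lattice_points (dilate m%:R (preorder_polytope R tau))).
Proof.
pose g (f : {ffun E -> 'I_(m * #|E|).+1}) : {ffun E -> int} :=
  [ffun e => (f e : nat)%:Z].
apply: (@sub_finite_set _ _ (g @` setT)); last exact: finite_image.
move=> a [x [x0 xI] /ffunP xa].
have Eid : order_ideal tau [set: E] by apply/'forall_forallP => ? ?; apply/implyP.
have a_bd e : 0 <= a e <= (m * #|E|)%N%:Z.
  have := xa e; rewrite !ffunE => ae; rewrite -(ler0z R) -(ler_int R) -ae.
  rewrite mulr_ge0//= -pmulrn natrM ler_wpM2l//.
  have := xI _ Eid; rewrite cardsT; apply: le_trans.
  by rewrite (bigD1 e) ?inE//= lerDl sumr_ge0.
exists [ffun e => inord `|a e|%N] => //; apply/ffunP => e.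
have /andP[a0 a1] := a_bd e; rewrite !ffunE inordK ?gez0_abs//.
by rewrite ltnS -lez_nat gez0_abs.
Qed.

(* Main.v *)
From HB Require Import structures.
Require Import Defs.
From mathcomp Require Import measurable_realfun zify ring.
From mathcomp Require polyrcf.

Set Implicit Arguments.
Unset Strict Implicit.
Unset Printing Implicit Defensive.
Import Order.TTheory GRing.Theory Num.Theory.

(* By Hall's theorem the lattice points of a sum of coordinate simplices are the
   degree vectors, on one side, of the partial assignments along the edges of a
   bipartite graph, and everything rests on Postnikov's duality: both sides of
   the graph have equally many such vectors.  The proof is a recursion on the
   edges.  A left degree vector of spanning trees either survives the deletion of
   an edge (l, r), or there is a largest set of left vertices whose Hall
   inequality the deletion breaks, and this set cuts the graph into two pieces,
   joined by no other edge in the direction of (l, r), on each of which a degree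
   vector is left over.  The cuts that occur are the same for the right side.

   Take E on the left and m copies of E on the right, with f adjacent to the
   copies of e when e <= f.  The left vectors are the lattice points of m Q_tau,
   the right ones are the arrays of increments of the multichains of length m in
   P_tau*, and sorting the latter by their last term gives the sum of products of
   binomial coefficients.

   For the volume, cubes of side 1/(m+1) give
   Ehr(m) <= (m+1)^n vol Q_tau <= Ehr(m+1), so vol Q_tau is the coefficient of
   degree n of the Ehrhart polynomial; times n! it is a sum of multinomial
   coefficients, which counts words by their content. *)

(** * Degree vectors of spanning trees of a bipartite graph *)

Section DegreeDuality.
Import mathcomp.boot.fintype mathcomp.boot.finset.
Local Open Scope nat_scope.

Definition neighbours (A B : finType) (es : seq (A * B)) (U : {set A})
    (T : {set B}) : {set B} :=
  [set r in T | [exists l in U, (l, r) \in es]].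

(** The tree edges at a nonempty [U] form a forest on [U] and its neighbours, hence the strict
    inequality; the total is the number of edges of a spanning tree on [S] and [T]. *)
Definition left_degrees (A B : finType) (es : seq (A * B)) (S : {set A})
    (T : {set B}) (d : {ffun A -> nat}) : Prop :=
  [/\ forall l, l \notin S -> d l = 0,
      (\sum_(l in S) d l).+1 = #|S| + #|T| &
      forall U : {set A}, U \subset S -> U != set0 ->
        \sum_(l in U) d l < #|U| + #|neighbours es U T|].

Definition swap_edges (A B : finType) (es : seq (A * B)) : seq (B * A) :=
  [seq (e.2, e.1) | e <- es].

(** Removing the tree edge [(l, r)] leaves a component on [S1] and [T1] that contains [l] and a
    complementary one that contains [r]. Edges from [S :\: S1] to [T1] remain allowed: only the
    direction of [(l, r)] is cut. *)
Definition edge_cut (A B : finType) (es : seq (A * B)) (S S1 : {set A})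
    (T T1 : {set B}) (l : A) (r : B) : Prop :=
  [/\ l \in S1, r \in T :\: T1, S1 \subset S, T1 \subset T &
      forall x y, x \in S1 -> y \in T :\: T1 -> (x, y) \notin es].

Definition join_degrees (A : finType) (d1 d2 : {ffun A -> nat}) (l : A) :
  {ffun A -> nat} := [ffun x => d1 x + d2 x + (x == l)].

(* [d] and [c] are the degree vectors of a spanning tree of the part of [es]
   inside [S] and [T].  The recursion does not produce every spanning tree: when
   a tree uses the edge [(l, r)], the cut this edge defines may contain no other
   remaining edge from the side of [l] to the side of [r].  The trees left are
   the cells of a triangulation of the root polytope of the graph, and each of
   them is determined by [d] alone, and by [c] alone. *)
Fixpoint tree_degrees (A B : finType) (es : seq (A * B)) (S : {set A})
    (T : {set B}) (d : {ffun A -> nat}) (c : {ffun B -> nat}) : Prop :=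
  if es is (l, r) :: es' then
    tree_degrees es' S T d c \/
    exists S1 T1 d1 d2 c1 c2,
      [/\ edge_cut es' S S1 T T1 l r, tree_degrees es' S1 T1 d1 c1,
          tree_degrees es' (S :\: S1) (T :\: T1) d2 c2,
          d = join_degrees d1 d2 l & c = join_degrees c1 c2 r]
  else [/\ #|S| + #|T| = 1, d = [ffun=> 0] & c = [ffun=> 0]].

Lemma neighboursP (A B : finType) (es : seq (A * B)) (U : {set A})
    (T : {set B}) (r : B) :
  reflect (r \in T /\ exists2 l, l \in U & (l, r) \in es)
          (r \in neighbours es U T).
Proof.
rewrite inE; apply: (iffP andP) => -[rT].
  by move=> /exists_inP[l lU lr]; split=> //; exists l.
by move=> [l lU lr]; split=> //; apply/exists_inP; exists l.
Qed.

Lemma neighbours_subset (A B : finType) (es : seq (A * B)) (U : {set A})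
    (T : {set B}) :
  neighbours es U T \subset T.
Proof. by apply/subsetP => r /neighboursP[]. Qed.

Lemma neighbours_mono (A B : finType) (es es' : seq (A * B)) (U U' : {set A})
    (T T' : {set B}) :
  {subset es <= es'} -> U \subset U' -> T \subset T' ->
  neighbours es U T \subset neighbours es' U' T'.
Proof.
move=> ee /subsetP UU /subsetP TT; apply/subsetP => r /neighboursP[rT [l lU lr]].
by apply/neighboursP; split; [exact: TT | exists l; [exact: UU | exact: ee]].
Qed.

Lemma neighboursU (A B : finType) (es : seq (A * B)) (U V : {set A})
    (T : {set B}) :
  neighbours es (U :|: V) T = neighbours es U T :|: neighbours es V T.
Proof.
apply/setP => r; rewrite !inE; case: (r \in T) => //=; apply/exists_inP/orP.
  move=> [l]; rewrite inE => /orP[] lU lr; [left|right];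
    by apply/exists_inP; exists l.
by move=> [] /exists_inP[l lU lr]; exists l => //; rewrite inE lU ?orbT.
Qed.

Lemma neighbours_cons (A B : finType) (es : seq (A * B)) (l : A) (r : B)
    (U : {set A}) (T : {set B}) :
  neighbours ((l, r) :: es) U T =
  neighbours es U T :|: (if (l \in U) && (r \in T) then [set r] else set0).
Proof.
apply/setP => y; rewrite in_setU; apply/neighboursP/orP.
  move=> [yT [x xU]]; rewrite in_cons => /orP[/eqP[xl yr]|xy].
    by right; rewrite -xl -yr xU yT inE.
  by left; apply/neighboursP; split=> //; exists x.
move=> [/neighboursP[yT [x xU xy]]|].
  by split=> //; exists x => //; rewrite in_cons xy orbT.
case: ifP => [/andP[lU rT]|]; last by rewrite inE.
by rewrite inE => /eqP ->; split=> //; exists l => //; rewrite mem_head.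
Qed.

Lemma sum_join_degrees (A : finType) (d1 d2 : {ffun A -> nat}) l (U : {set A}) :
  \sum_(x in U) join_degrees d1 d2 l x =
  \sum_(x in U) d1 x + \sum_(x in U) d2 x + (l \in U).
Proof.
under eq_bigr do rewrite ffunE.
rewrite !big_split /=; congr (_ + _).
case lU: (l \in U); last first.
  by rewrite big1// => x xU; case: eqP => // xl; rewrite -xl xU in lU.
rewrite (bigD1 l) //= eqxx big1 // => x /andP[_ /negPf ->] //.
Qed.

Lemma sum_support (A : finType) (d : {ffun A -> nat}) (S U : {set A}) :
  (forall l, l \notin S -> d l = 0) ->
  \sum_(l in U) d l = \sum_(l in U :&: S) d l.
Proof.
move=> d0; rewrite (big_setID S) /= [X in _ + X]big1 ?addn0 // => x.
by rewrite inE => /andP[/d0].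
Qed.

Lemma card_setU_setD (B : finType) (X Y T T1 : {set B}) :
  X \subset T1 -> Y \subset T :\: T1 -> #|X :|: Y| = #|X| + #|Y|.
Proof.
move=> XT YT; rewrite -cardsUI (_ : X :&: Y = set0) ?cards0 ?addn0 //.
apply/eqP; rewrite -subset0; apply/subsetP => y; rewrite inE => /andP[].
by move=> /(subsetP XT) yT /(subsetP YT); rewrite inE yT.
Qed.

(** When [U] meets both pieces, the two strict inequalities leave one unit to spare, which pays for
    [(l, r)]; the neighbours they count lie in the disjoint sets [T1] and [T :\: T1]. *)
Lemma edge_cut_left_degrees (A B : finType) (es : seq (A * B))
    (S S1 : {set A}) (T T1 : {set B}) (l : A) (r : B)
    (d1 d2 : {ffun A -> nat}) :
  edge_cut es S S1 T T1 l r ->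
  left_degrees es S1 T1 d1 -> left_degrees es (S :\: S1) (T :\: T1) d2 ->
  left_degrees ((l, r) :: es) S T (join_degrees d1 d2 l).
Proof.
move=> [lS1 rT S1S T1T sep] [d10 d1s d1U] [d20 d2s d2U].
have lS : l \in S by apply: (subsetP S1S).
have cS := cardsID S1 S; rewrite (setIidPr S1S) in cS.
have cT := cardsID T1 T; rewrite (setIidPr T1T) in cT.
split.
- move=> x xS; rewrite ffunE d10; last by apply: contra xS => /(subsetP S1S).
  rewrite d20; last by rewrite inE (negPf xS) andbF.
  by case: eqP => // xl; rewrite xl lS in xS.
- rewrite sum_join_degrees lS (sum_support _ d10) (sum_support (S := S :\: S1) S d20).
  rewrite (setIidPr S1S) (setIidPr (subsetDl _ _)); lia.
move=> U US U0; rewrite sum_join_degrees (sum_support _ d10).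
rewrite (sum_support (S := S :\: S1) U d20).
have cU := cardsID S1 U.
have -> : U :&: (S :\: S1) = U :\: S1 by rewrite setIDA (setIidPl US).
set U1 := U :&: S1 in cU *; set U2 := U :\: S1 in cU *.
pose N1 := neighbours es U1 T1; pose N2 := neighbours es U2 (T :\: T1).
have dN : #|N1 :|: N2| = #|N1| + #|N2|.
  exact: card_setU_setD (neighbours_subset _ _ _) (neighbours_subset _ _ _).
have Nsub : N1 :|: N2 \subset neighbours ((l, r) :: es) U T.
  rewrite subUset; apply/andP; split; apply: neighbours_mono => //;
    rewrite ?subsetIl ?subsetDl //; by move=> e; rewrite in_cons orbC => ->.
have cN := subset_leq_card Nsub.
have h1 : U1 != set0 -> \sum_(x in U1) d1 x < #|U1| + #|N1|.
  by apply: d1U; rewrite subsetIr.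
have h2 : U2 != set0 -> \sum_(x in U2) d2 x < #|U2| + #|N2|.
  by apply: d2U; rewrite setSD.
have lU : (l \in U) = (l \in U1) by rewrite inE lS1 andbT.
have [U1e|U1n] := eqVneq U1 set0.
  have U2n : U2 != set0.
    by apply: contra U0 => /eqP U2e; rewrite -(setID U S1) -/U1 -/U2 U1e U2e setU0.
  move: (h2 U2n) cU cN; rewrite dN lU U1e inE big_set0 cards0; clear; lia.
have [U2e|U2n] := eqVneq U2 set0; last first.
  by move: (h1 U1n) (h2 U2n) cU cN; rewrite dN; case: (l \in U); clear; lia.
have N2e : #|N2| = 0.
  by apply/eqP; rewrite cards_eq0 -subset0; apply/subsetP => y
    /neighboursP[_ [x]]; rewrite U2e inE.
move: (h1 U1n) cU cN; rewrite dN N2e U2e big_set0 cards0.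
case lUe: (l \in U); last by clear; lia.
(* Now [U] lies in [S1] and contains [l]: the unit for the new edge comes from [r], a neighbour
   outside [T1]. *)
suff : #|N1| < #|neighbours ((l, r) :: es) U T| by clear; lia.
apply: proper_card; apply/properP; split.
  by apply: subset_trans Nsub; apply: subsetUl.
exists r; first by apply/neighboursP; move: rT; rewrite inE => /andP[_ rT];
  split => //; exists l => //; rewrite mem_head.
apply/negP => /(subsetP (neighbours_subset _ _ _)).
by move: rT; rewrite inE => /andP[/negPf ->].
Qed.

(** Without crossing edges the neighbours of [S1] lie in [T1], and the inequality for [S1] itself,
    whose degree sum is known, leaves no room for fewer. So [S1] alone determines the cut. *)
Lemma edge_cut_neighbours (A B : finType) (es : seq (A * B)) (S S1 : {set A})
    (T T1 : {set B}) (l : A) (r : B) (d1 : {ffun A -> nat}) :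
  edge_cut es S S1 T T1 l r -> left_degrees es S1 T1 d1 ->
  T1 = neighbours es S1 T.
Proof.
move=> [lS1 rT S1S T1T sep] [d10 d1s d1U].
have NT : neighbours es S1 T \subset T1.
  apply/subsetP => y /neighboursP[yT [x xS xy]]; apply/negPn/negP => yT1.
  by move: (sep x y xS); rewrite inE yT1 yT xy => /(_ isT).
apply/eqP; rewrite eq_sym eqEcard NT /=.
have S10 : S1 != set0 by apply/set0Pn; exists l.
have := d1U S1 (subxx _) S10.
have : neighbours es S1 T1 \subset neighbours es S1 T by apply: neighbours_mono.
by move=> /subset_leq_card; lia.
Qed.

Definition violates (A B : finType) (es : seq (A * B)) (T : {set B})
    (d : {ffun A -> nat}) (U : {set A}) : bool :=
  #|U| + #|neighbours es U T| <= \sum_(l in U) d l.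

(* A degree vector thus determines the cut it was glued along: [S1] is the
   largest set violating the inequalities once [(l, r)] is deleted. *)
Lemma edge_cut_violates (A B : finType) (es : seq (A * B)) (S S1 : {set A})
    (T T1 : {set B}) (l : A) (r : B) (d1 d2 : {ffun A -> nat}) :
  edge_cut es S S1 T T1 l r ->
  left_degrees es S1 T1 d1 -> left_degrees es (S :\: S1) (T :\: T1) d2 ->
  violates es T (join_degrees d1 d2 l) S1 /\
  forall U : {set A}, U \subset S -> S1 \subset U ->
    violates es T (join_degrees d1 d2 l) U -> U = S1.
Proof.
move=> hcut h1 h2; have T1N := edge_cut_neighbours hcut h1.
case: hcut h1 h2 => [lS1 rT S1S T1T sep] [d10 d1s d1U] [d20 d2s d2U].
have sumE (U : {set A}) : U \subset S -> S1 \subset U ->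
    \sum_(x in U) join_degrees d1 d2 l x = #|S1| + #|T1| + \sum_(x in U :\: S1) d2 x.
  move=> US S1U; rewrite sum_join_degrees (sum_support _ d10).
  rewrite (sum_support (S := S :\: S1) U d20) (setIidPr S1U).
  by rewrite setIDA (setIidPl US) (subsetP S1U) // -d1s; lia.
split; first by rewrite /violates sumE // setDv big_set0 addn0 -T1N.
move=> U US S1U; rewrite /violates sumE // => viol; apply/eqP.
rewrite eq_sym eqEsubset S1U /= -setD_eq0; apply/negPn/negP => U2n.
have := d2U _ (setSD S1 US) U2n.
have cU := cardsID S1 U; rewrite (setIidPr S1U) in cU.
suff : #|T1| + #|neighbours es (U :\: S1) (T :\: T1)| <= #|neighbours es U T|.
  lia.
have <- : #|T1 :|: neighbours es (U :\: S1) (T :\: T1)| =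
    #|T1| + #|neighbours es (U :\: S1) (T :\: T1)|.
  exact: card_setU_setD (subxx _) (neighbours_subset _ _ _).
apply: subset_leq_card; rewrite subUset {1}T1N.
by apply/andP; split; apply: neighbours_mono => //; rewrite subsetDl.
Qed.

Lemma tree_left_degrees (A B : finType) (es : seq (A * B)) (S : {set A})
    (T : {set B}) (d : {ffun A -> nat}) (c : {ffun B -> nat}) :
  tree_degrees es S T d c -> left_degrees es S T d.
Proof.
elim: es S T d c => [|[l r] es IH] S T d c /=.
  move=> [ST -> _]; split => [x|| U US U0]; rewrite ?ffunE //.
    by rewrite big1 // => x _; rewrite ffunE.
  rewrite big1 => [|x _]; last by rewrite ffunE.
  by rewrite addn_gt0 card_gt0 U0.
move=> [/IH[d0 ds dU]|[S1 [T1 [d1 [d2 [c1 [c2 [hcut /IH h1 /IH h2 -> _]]]]]]]].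
  split=> // U US U0; apply: leq_trans (dU U US U0) _; rewrite leq_add2l.
  by apply/subset_leq_card/neighbours_mono => // e; rewrite in_cons orbC => ->.
exact: (edge_cut_left_degrees hcut h1 h2).
Qed.

Lemma mem_swap_edges (A B : finType) (es : seq (A * B)) x y :
  ((y, x) \in swap_edges es) = ((x, y) \in es).
Proof.
apply/mapP/idP => [[[a b] ab [-> ->]] //|xy].
by exists (x, y).
Qed.

(** A cut is a symmetric notion: seen from the other side the piece of [r] comes first, and the
    pairs that must not be edges are the same. *)
Lemma tree_degrees_swap (A B : finType) (es : seq (A * B)) (S : {set A})
    (T : {set B}) (d : {ffun A -> nat}) (c : {ffun B -> nat}) :
  tree_degrees es S T d c -> tree_degrees (swap_edges es) T S c d.
Proof.
elim: es S T d c => [|[l r] es IH] S T d c /=.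
  by move=> [ST -> ->]; split => //; rewrite addnC.
move=> [/IH|[S1 [T1 [d1 [d2 [c1 [c2 [hcut /IH h1 /IH h2 -> ->]]]]]]]].
  by left.
right; exists (T :\: T1), (S :\: S1), c2, c1, d2, d1.
case: hcut => [lS1 rT S1S T1T sep].
have TT : T :\: (T :\: T1) = T1 by rewrite setDDr setDv set0U (setIidPr T1T).
have SS : S :\: (S :\: S1) = S1 by rewrite setDDr setDv set0U (setIidPr S1S).
rewrite TT SS; split => //.
- split; rewrite ?SS ?subsetDl // => y x yT xS.
  by rewrite mem_swap_edges sep.
- by apply/ffunP => x; rewrite !ffunE (addnC (c1 x)).
- by apply/ffunP => x; rewrite !ffunE (addnC (d1 x)).
Qed.

Lemma left_degrees_nil (A B : finType) (S : {set A}) (T : {set B})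
    (d : {ffun A -> nat}) :
  left_degrees ([::] : seq (A * B)) S T d ->
  #|S| + #|T| = 1 /\ d = [ffun=> 0].
Proof.
move=> [d0 ds dU].
have N0 U : #|neighbours ([::] : seq (A * B)) U T| = 0.
  by apply/eqP; rewrite cards_eq0 -subset0; apply/subsetP => y
    /neighboursP[_ [x]].
have dz x : d x = 0.
  have [xS|/d0 //] := boolP (x \in S).
  have := dU [set x]; rewrite sub1set xS big_set1 cards1 N0.
  have -> : [set x] != set0 by apply/set0Pn; exists x; rewrite inE.
  by move=> /(_ isT isT); lia.
split; last by apply/ffunP => x; rewrite ffunE.
by rewrite -ds big1.
Qed.

(** This is submodularity of the number of neighbours: a neighbour of the intersection is a
    neighbour of both sets. *)
Lemma violatesU (A B : finType) (es : seq (A * B)) (T : {set B})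
    (d : {ffun A -> nat}) (U V : {set A}) :
  violates es T d U -> violates es T d V ->
  \sum_(l in U :&: V) d l <= #|U :&: V| + #|neighbours es (U :&: V) T| ->
  violates es T d (U :|: V).
Proof.
rewrite /violates => vU vV vI.
have sE : \sum_(l in U :|: V) d l + \sum_(l in U :&: V) d l =
    \sum_(l in U) d l + \sum_(l in V) d l.
  rewrite (big_setID V) /= (setIidPr (subsetUr U V)) setDUl setDv setU0.
  by rewrite (big_setID (A := U) V) /=; lia.
have cE := cardsUI U V.
have nE := cardsUI (neighbours es U T) (neighbours es V T).
rewrite -neighboursU in nE.
have nI : #|neighbours es (U :&: V) T| <=
    #|neighbours es U T :&: neighbours es V T|.
  apply: subset_leq_card; rewrite subsetI.
  by apply/andP; split; apply: neighbours_mono; rewrite ?subsetIl ?subsetIr.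
lia.
Qed.

(** * Sets whose inequality breaks when an edge is deleted *)

Section Violating.
Variables (A B : finType) (es : seq (A * B)) (S : {set A}) (T : {set B}).
Variables (l : A) (r : B) (d : {ffun A -> nat}).
Hypothesis dL : left_degrees ((l, r) :: es) S T d.

(** Restoring [(l, r)] repairs the inequality and can add only [r] to the neighbours, so the strict
    inequality had failed by exactly one. *)
Lemma violates_cut (U : {set A}) : U \subset S -> U != set0 ->
  violates es T d U ->
  [/\ l \in U, r \in T, r \notin neighbours es U T &
      \sum_(x in U) d x = #|U| + #|neighbours es U T|].
Proof.
move=> US U0; rewrite /violates => v; case: dL => _ _ /(_ U US U0).
rewrite neighbours_cons; case: ifP => [/andP[lU rT]|_]; last first.
  by rewrite setU0; lia.
rewrite setUC; have [rN|rN] := boolP (r \in neighbours es U T).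
  by rewrite (setUidPr _) ?sub1set //; lia.
by rewrite cardsU1 rN => h; split => //; lia.
Qed.

(** Both sets contain [l], so their intersection is nonempty; its degree sum cannot exceed the value
    in [violates_cut], and submodularity applies. *)
Lemma violates_union (U V : {set A}) : U \subset S -> U != set0 ->
  V \subset S -> V != set0 ->
  violates es T d U -> violates es T d V -> violates es T d (U :|: V).
Proof.
move=> US U0 VS V0 vU vV; apply: violatesU => //.
have [lU _ _ _] := violates_cut US U0 vU.
have [lV _ _ _] := violates_cut VS V0 vV.
have [//|v] := leqP (\sum_(x in U :&: V) d x)
  (#|U :&: V| + #|neighbours es (U :&: V) T|).
have UV0 : U :&: V != set0 by apply/set0Pn; exists l; rewrite inE lU.
have [_ _ _ e] :=
  violates_cut (subset_trans (subsetIl _ _) US) UV0 (ltnW v).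
by rewrite e ltnn in v.
Qed.

(** The vector [d] is restricted to [S1], less one at [l] for the edge [(l, r)], and to the
    complement. The first piece inherits its inequalities from [d]; those of the second come from
    maximality. *)
Lemma maximal_violates_split (S1 : {set A}) : S1 \subset S -> S1 != set0 ->
  violates es T d S1 ->
  (forall U : {set A}, U \subset S -> S1 \subset U -> violates es T d U ->
     U = S1) ->
  exists d1 d2, let T1 := neighbours es S1 T in
  [/\ edge_cut es S S1 T T1 l r, left_degrees es S1 T1 d1,
      left_degrees es (S :\: S1) (T :\: T1) d2 & d = join_degrees d1 d2 l].
Proof.
move=> S1S S10 v1 max1; have [lS1 rT rN sumS1] := violates_cut S1S S10 v1.
pose T1 := neighbours es S1 T; have T1T : T1 \subset T := neighbours_subset _ _ _.
have [d0 ds dU] := dL.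
(* Otherwise [S1 :\ l], which does not see the deleted edge, would carry the whole degree sum of
   [S1], too much for its own inequality. *)
have dl : 0 < d l.
  move: sumS1; rewrite (big_setD1 l) //=.
  have [->|ne] := eqVneq (S1 :\ l) set0.
    by rewrite big_set0; have := card_gt0 S1; rewrite S10; lia.
  have := dU (S1 :\ l) (subset_trans (subsetDl _ _) S1S) ne.
  rewrite neighbours_cons setD11 /= setU0.
  have : #|neighbours es (S1 :\ l) T| <= #|T1|.
    by apply/subset_leq_card/neighbours_mono; rewrite ?subsetDl.
  by rewrite (cardsD1 l S1) lS1 -/T1; lia.
pose d1 : {ffun A -> nat} := [ffun x => if x \in S1 then d x - (x == l) else 0].
pose d2 : {ffun A -> nat} := [ffun x => if x \in S1 then 0 else d x].
have dE : d = join_degrees d1 d2 l.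
  apply/ffunP => x; rewrite !ffunE; case: ifP => xS1.
    by case: eqP => [->|_]; lia.
  by case: eqP => [xl|_]; [rewrite xl lS1 in xS1 | rewrite !add0n addn0].
have sep x y : x \in S1 -> y \in T :\: T1 -> (x, y) \notin es.
  move=> xS; rewrite inE => /andP[yT1 yT]; apply: contra yT1 => xy.
  by apply/neighboursP; split => //; exists x.
have d10 x : x \notin S1 -> d1 x = 0 by rewrite ffunE => /negPf ->.
have d20 x : x \notin S :\: S1 -> d2 x = 0.
  by rewrite inE negb_and negbK ffunE; case: ifP => //= _; apply: d0.
have s1 (U : {set A}) : U \subset S1 ->
    \sum_(x in U) d x = \sum_(x in U) d1 x + (l \in U).
  move=> US; rewrite dE sum_join_degrees [X in _ + X + _]big1 ?addn0 // => x xU.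
  by rewrite ffunE (subsetP US).
have s2 (U : {set A}) : U \subset S :\: S1 ->
    \sum_(x in U) d x = \sum_(x in U) d2 x.
  move=> US; apply: eq_bigr => x /(subsetP US); rewrite !inE ffunE.
  by case/andP => /negPf ->.
have cS := cardsID S1 S; rewrite (setIidPr S1S) in cS.
have cT := cardsID T1 T; rewrite (setIidPr T1T) in cT.
exists d1, d2; cbv zeta; rewrite -/T1; split => //.
- by split => //; rewrite in_setD rN rT.
- split => //; first by have := s1 S1 (subxx _); rewrite lS1 sumS1 -/T1; lia.
  move=> U US U0; have := dU U (subset_trans US S1S) U0.
  rewrite s1 // neighbours_cons rT andbT.
  have -> : neighbours es U T = neighbours es U T1.
    apply/eqP; rewrite eqEsubset; apply/andP; split; last exact: neighbours_mono.
    apply/subsetP => y /neighboursP[yT [x xU xy]]; apply/neighboursP.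
    split; last by exists x.
    by apply/neighboursP; split => //; exists x => //; apply: (subsetP US).
  case: (boolP (l \in U)) => lU; last by rewrite setU0; clear; lia.
  by rewrite setUC cardsU1; case: (_ \notin _); clear; lia.
- split => //.
    have := s2 _ (subxx _); have := big_setID (A := S) (aop := addn) S1 d => /=.
    by rewrite (setIidPr S1S) sumS1 -/T1; lia.
  move=> U US U0; rewrite -s2 // ltnNge; apply/negP => vU.
  have dis : U :&: S1 = set0.
    apply/eqP; rewrite -subset0; apply/subsetP => x; rewrite inE => /andP[].
    by move=> /(subsetP US); rewrite inE => /andP[/negPf ->].
  (* A violating set in the second piece could be added to [S1], against maximality: the neighbours
     gained are only those outside [T1]. *)
  have : violates es T d (S1 :|: U).
    rewrite /violates neighboursU.
    have -> : \sum_(x in S1 :|: U) d x = \sum_(x in S1) d x + \sum_(x in U) d x.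
      rewrite (big_setID S1) /= setIUl setIid dis setU0 setDUl setDv set0U.
      by rewrite (setDidPl _) // -setI_eq0 dis.
    have := cardsUI S1 U; rewrite setIC dis cards0 => cU.
    have -> : T1 :|: neighbours es U T =
        T1 :|: neighbours es U (T :\: T1).
      apply/setP => y; rewrite !(in_setU, in_set, in_setD).
      by case: (y \in T); case: [exists x in S1, _]; case: [exists x in U, _].
    rewrite -/T1 (card_setU_setD (subxx T1) (neighbours_subset es U _)).
    by move: sumS1 vU cU; rewrite -/T1; clear; lia.
  move=> /(max1 _ _ (subsetUl _ _)); rewrite subUset S1S.
  rewrite (subset_trans US (subsetDl _ _)) => /(_ isT) e.
  case/set0Pn: U0 => x xU; have : x \in U :&: S1.
    by rewrite inE xU -e inE xU orbT.
  by rewrite dis inE.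
Qed.

End Violating.

Lemma left_degrees_tree (A B : finType) (es : seq (A * B)) (S : {set A})
    (T : {set B}) (d : {ffun A -> nat}) :
  left_degrees es S T d -> exists c, tree_degrees es S T d c.
Proof.
elim: es S T d => [|[l r] es IH] S T d dL.
  by have [ST d0] := left_degrees_nil dL; exists [ffun=> 0].
pose Q (U : {set A}) := [&& U \subset S, U != set0 & violates es T d U].
have [/existsP/= [U0 QU0]|/existsPn noQ] := boolP [exists U, Q U]; last first.
  have [c tc] : exists c, tree_degrees es S T d c.
    apply: IH; case: dL => d0 ds _; split => // U US U0.
    by have := noQ U; rewrite /Q US U0 /violates -ltnNge.
  by exists c; left.
have [S1 /maxsetP[/and3P[S1S S10 v1] max1] _] := maxset_exists QU0.
have [|d1 [d2 [hcut h1 h2 dE]]] := maximal_violates_split dL S1S S10 v1.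
  move=> U US S1U vU; apply: max1 => //; rewrite /Q US vU.
  by rewrite (subset_neq0 S1U S10).
have [c1 t1] := IH _ _ _ h1; have [c2 t2] := IH _ _ _ h2.
exists (join_degrees c1 c2 r); right.
by exists S1, (neighbours es S1 T), d1, d2, c1, c2.
Qed.

Lemma join_degrees_inj (A : finType) (S1 : {set A})
    (d1 d2 e1 e2 : {ffun A -> nat}) l :
  (forall x, x \notin S1 -> d1 x = 0) -> (forall x, x \notin S1 -> e1 x = 0) ->
  (forall x, x \in S1 -> d2 x = 0) -> (forall x, x \in S1 -> e2 x = 0) ->
  join_degrees d1 d2 l = join_degrees e1 e2 l -> d1 = e1 /\ d2 = e2.
Proof.
move=> d10 e10 d20 e20 /ffunP E.
split; apply/ffunP => x; have := E x; rewrite !ffunE => /addIn;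
  have [xS|xS] := boolP (x \in S1);
  rewrite ?(d20 x xS) ?(e20 x xS) ?(d10 x xS) ?(e10 x xS) ?addn0 ?add0n //.
Qed.

(** The two alternatives exclude each other, as [S1] violates an inequality that a tree without
    [(l, r)] satisfies. Two cuts for the same [d] coincide: the union of their left sets violates
    too, and both are maximal. *)
Lemma tree_degrees_det (A B : finType) (es : seq (A * B)) (S : {set A})
    (T : {set B}) (d : {ffun A -> nat}) (c c' : {ffun B -> nat}) :
  tree_degrees es S T d c -> tree_degrees es S T d c' -> c = c'.
Proof.
elim: es S T d c c' => [|[l r] es IH] S T d c c'.
  by move=> [_ _ ->] [_ _ ->].
have excl S1 T1 d1 d2 c1 c2 c3 : edge_cut es S S1 T T1 l r ->
    tree_degrees es S1 T1 d1 c1 ->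
    tree_degrees es (S :\: S1) (T :\: T1) d2 c2 ->
    d = join_degrees d1 d2 l -> ~ tree_degrees es S T d c3.
  move=> hcut /tree_left_degrees h1 /tree_left_degrees h2 dE.
  have [v _] := edge_cut_violates hcut h1 h2.
  move=> /tree_left_degrees[_ _] /(_ S1).
  case: hcut => lS1 _ S1S _ _; have S10 : S1 != set0 by apply/set0Pn; exists l.
  by move=> /(_ S1S S10); rewrite ltnNge dE; move: v; rewrite /violates => ->.
move=> tc tc'; have dL := tree_left_degrees tc; move: tc tc'.
move=> [t|[S1 [T1 [d1 [d2 [c1 [c2 [hcut t1 t2 dE ->]]]]]]]];
  move=> [t'|[S1' [T1' [d1' [d2' [c1' [c2' [hcut' t1' t2' dE' ->]]]]]]]].
- exact: IH t t'.
- by case: (excl _ _ _ _ _ _ _ hcut' t1' t2' dE' t).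
- by case: (excl _ _ _ _ _ _ _ hcut t1 t2 dE t').
have h1 := tree_left_degrees t1; have h2 := tree_left_degrees t2.
have h1' := tree_left_degrees t1'; have h2' := tree_left_degrees t2'.
have [v m] := edge_cut_violates hcut h1 h2; rewrite -dE in v m.
have [v' m'] := edge_cut_violates hcut' h1' h2'; rewrite -dE' in v' m'.
have N := edge_cut_neighbours hcut h1; have N' := edge_cut_neighbours hcut' h1'.
have [lS1 _ S1S _ _] := hcut; have [lS1' _ S1S' _ _] := hcut'.
have vU : violates es T d (S1 :|: S1').
  by apply: (violates_union dL) => //; apply/set0Pn; exists l.
have US : S1 :|: S1' \subset S by rewrite subUset S1S.
have eS : S1 = S1'.
  by rewrite -[LHS](m _ US (subsetUl _ _) vU) (m' _ US (subsetUr _ _) vU).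
rewrite -eS in N' t1' t2' h1' h2'; rewrite -N in N'; rewrite N' in t1' t2' h1' h2'.
have [e1 e2] : d1 = d1' /\ d2 = d2'.
  case: h1 h1' h2 h2' => [z1 _ _] [z1' _ _] [z2 _ _] [z2' _ _].
  apply: (@join_degrees_inj _ S1 _ _ _ _ l) => //; last by rewrite -dE -dE'.
    by move=> x xS; apply: z2; rewrite inE xS.
  by move=> x xS; apply: z2'; rewrite inE xS.
rewrite -e1 in t1'; rewrite -e2 in t2'.
by rewrite (IH _ _ _ _ _ t1 t1') (IH _ _ _ _ _ t2 t2').
Qed.

(** * Hall vectors and the cone over a bipartite graph *)

Definition hall_vector (E F : finType) (G : E -> F -> bool)
    (b : {ffun E -> nat}) : Prop :=
  forall U : {set E},
    \sum_(x in U) b x <= #|[set y | [exists x in U, G x y]]|.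

(* A vertex joined to everything on each side makes spanning trees out of the
   partial assignments described by [hall_vector]. *)
Definition cone (E F : finType) (G : E -> F -> bool) (x : option E)
    (y : option F) : bool :=
  match x, y with Some x, Some y => G x y | _, _ => true end.

(** With [k = #|F|], the shift by one turns Hall's inequality into the strict one of [left_degrees],
    the opposite apex being one more neighbour. The apex [None] takes what is left of the
    [#|E| + #|F| + 1] edges of a spanning tree. *)
Definition cone_degree (E : finType) (k : nat) (b : {ffun E -> nat}) :
  {ffun option E -> nat} :=
  [ffun o => if o is Some x then (b x).+1 else k.+1 - \sum_x b x].

Lemma cone_degree_Some (E : finType) k (b : {ffun E -> nat}) x :
  cone_degree k b (Some x) = (b x).+1.
Proof. by rewrite ffunE. Qed.

Lemma cone_degree_None (E : finType) k (b : {ffun E -> nat}) :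
  cone_degree k b None = k.+1 - \sum_x b x.
Proof. by rewrite ffunE. Qed.

Lemma cone_degree_inj (E : finType) k : injective (@cone_degree E k).
Proof.
by move=> b b' /ffunP e; apply/ffunP => x; have := e (Some x); rewrite !ffunE => -[].
Qed.

Lemma sum_imset_Some (E : finType) (d : {ffun option E -> nat}) (U : {set E}) :
  \sum_(o in Some @: U) d o = \sum_(x in U) d (Some x).
Proof. by rewrite big_imset //= => x y _ _ []. Qed.

Lemma sum_cone_degree (E : finType) k (b : {ffun E -> nat}) (U : {set E}) :
  \sum_(o in Some @: U) cone_degree k b o = \sum_(x in U) b x + #|U|.
Proof.
rewrite sum_imset_Some -sum1_card -big_split /=.
by apply: eq_bigr => x _; rewrite cone_degree_Some addn1.
Qed.

Lemma sum_option (E : finType) (d : {ffun option E -> nat}) :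
  \sum_(o in [set: option E]) d o = d None + \sum_x d (Some x).
Proof.
have -> : [set: option E] = None |: Some @: [set: E].
  apply/setP => -[x|]; rewrite !inE //=.
  by apply/esym/imsetP; exists x.
rewrite big_setU1 /=; last by apply/imsetP => -[].
by rewrite sum_imset_Some; congr (_ + _); apply: eq_bigl => x; rewrite inE.
Qed.

Section Cone.
Variables (E F : finType) (G : E -> F -> bool) (es : seq (option E * option F)).
Hypothesis esG : forall x y, ((x, y) \in es) = cone G x y.

Let nbr (U : {set E}) := [set y | [exists x in U, G x y]].

Lemma neighbours_cone (U : {set E}) : U != set0 ->
  #|neighbours es (Some @: U) setT| = #|nbr U|.+1.
Proof.
move=> /set0Pn[x0 x0U].
have -> : neighbours es (Some @: U) setT = None |: Some @: nbr U.
  apply/setP => o; apply/neighboursP/setU1P => [[_ [_ /imsetP[x xU ->]]]|].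
    rewrite esG; case: o => [y|] /= Gxy; [right|by left].
    by apply/imsetP; exists y => //; rewrite inE; apply/exists_inP; exists x.
  move=> [->|/imsetP[y]].
    by split=> //; exists (Some x0); rewrite ?esG //; apply: imset_f.
  rewrite inE => /exists_inP[x xU Gxy] ->; split => //.
  by exists (Some x); rewrite ?esG //; apply: imset_f.
rewrite cardsU1 card_imset; last by move=> ? ? [].
by rewrite (_ : None \notin _) //; apply/imsetP => -[].
Qed.

Lemma hall_vector_cone b : hall_vector G b ->
  left_degrees es setT setT (cone_degree #|F| b).
Proof.
move=> hb; have bF : \sum_x b x <= #|F|.
  have := hb setT; rewrite (eq_bigl xpredT) => [|x]; last by rewrite inE.
  by move=> /leq_trans; apply; rewrite max_card.
have tot : (\sum_(o in [set: option E]) cone_degree #|F| b o).+1 =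
    #|[set: option E]| + #|[set: option F]|.
  rewrite sum_option !cardsT !card_option cone_degree_None.
  have -> : \sum_x cone_degree #|F| b (Some x) = \sum_x b x + #|E|.
    transitivity (\sum_x (b x + 1)); last by rewrite big_split sum_nat_const muln1.
    by apply: eq_bigr => x _; rewrite cone_degree_Some addn1.
  by move: bF; clear; lia.
have pos o : 0 < cone_degree #|F| b o.
  by case: o => [x|]; rewrite ?cone_degree_Some ?cone_degree_None ?subn_gt0 ?ltnS.
split=> // [l|U _ U0]; first by rewrite inE.
(* A set with the apex has every right vertex as a neighbour; its inequality follows from the total,
   as each left vertex outside it has degree at least one. *)
have [NU|NU] := boolP (None \in U).
  have -> : neighbours es U setT = setT.
    apply/setP => y; rewrite in_setT; apply/neighboursP; split => //.
    by exists None => //; rewrite esG.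
  have : \sum_(o in [set: option E]) cone_degree #|F| b o =
      \sum_(o in U) cone_degree #|F| b o + \sum_(o in ~: U) cone_degree #|F| b o.
    by rewrite (big_setID U) /= setTI setTD.
  have := cardsID U [set: option E]; rewrite setTI setTD.
  have : #|~: U| <= \sum_(o in ~: U) cone_degree #|F| b o.
    by rewrite -sum1_card; apply: leq_sum => o _; apply: pos.
  have arith (s sU sC e f u c : nat) : s.+1 = e.+1 + f.+1 -> c <= sC ->
    u + c = e.+1 -> s = sU + sC -> sU < u + f.+1 by clear; lia.
  by move: tot; rewrite !cardsT !card_option; apply: arith.
have UE : U = Some @: [set x | Some x \in U].
  apply/setP => -[x|]; last first.
    by rewrite (negPf NU); apply/esym/imsetP => -[].
  apply/idP/imsetP => [xU|[y]]; first by exists x; rewrite ?inE.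
  by rewrite inE => yU [->].
set V := [set x | _] in UE; rewrite UE sum_cone_degree neighbours_cone.
  rewrite card_imset; last by move=> ? ? [].
  by have := hb V; rewrite -/(nbr V); clear; lia.
apply: contra U0 => /eqP V0; rewrite UE V0 imset0 //.
Qed.

Lemma cone_hall_vector d : left_degrees es setT setT d ->
  exists2 b, hall_vector G b & d = cone_degree #|F| b.
Proof.
move=> [_ tot dU]; rewrite !cardsT !card_option in tot.
(* The inequality for all the other left vertices leaves at least one edge of the total to
   [Some x]. *)
have pos x : 0 < d (Some x).
  move: tot; rewrite (big_setD1 (Some x)) //=.
  have := dU (setT :\ Some x) (subsetT _).
  have -> : [set: option E] :\ Some x != set0.
    by apply/set0Pn; exists None; rewrite !inE.
  have := max_card (mem (neighbours es (setT :\ Some x) setT)).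
  have := cardsD1 (Some x) [set: option E].
  have arith (dx sD uD N e f : nat) : e.+1 = true + uD -> N <= f.+1 ->
    sD < uD + N -> (dx + sD).+1 = e.+1 + f.+1 -> 0 < dx by clear; lia.
  by rewrite !cardsT in_setT !card_option => h1 h2 /(_ isT); apply: arith h1 h2.
pose b : {ffun E -> nat} := [ffun x => (d (Some x)).-1].
have dS x : d (Some x) = (b x).+1 by rewrite ffunE prednK.
have dE : d = cone_degree #|F| b.
  apply/ffunP => -[x|]; rewrite ?cone_degree_Some ?cone_degree_None ?dS //.
  move: tot; rewrite sum_option.
  have -> : \sum_x d (Some x) = \sum_x b x + #|E|.
    transitivity (\sum_x (b x + 1)); last by rewrite big_split sum_nat_const muln1.
    by apply: eq_bigr => x _; rewrite dS addn1.
  have arith (dN s e f : nat) : (dN + (s + e)).+1 = e.+1 + f.+1 -> dN = f.+1 - s.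
    by clear; lia.
  exact: arith.
exists b => // U; have [->|U0] := eqVneq U set0; first by rewrite big_set0.
have := dU (Some @: U) (subsetT _); rewrite dE sum_cone_degree neighbours_cone //.
rewrite card_imset; last by move=> ? ? [].
rewrite -/(nbr U); set X := Some @: U != set0.
have -> : X by case/set0Pn: U0 => x xU; apply/set0Pn; exists (Some x); apply: imset_f.
by move=> /(_ isT); clear; lia.
Qed.

End Cone.

(** Two vectors are dual when one tree of the recursion, run over the edges of the cone in the order
    of [enum], has both as degrees. *)
Definition hall_dual (E F : finType) (G : E -> F -> bool) (b : {ffun E -> nat})
    (c : {ffun F -> nat}) : Prop :=
  tree_degrees [seq p <- enum {: option E * option F} | cone G p.1 p.2]
    setT setT (cone_degree #|F| b) (cone_degree #|E| c).

Lemma hall_dual_ex (E F : finType) (G : E -> F -> bool) b :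
  hall_vector G b -> exists2 c, hall_vector (fun y x => G x y) c & hall_dual G b c.
Proof.
set es := [seq p <- enum {: option E * option F} | cone G p.1 p.2].
have esG x y : ((x, y) \in es) = cone G x y.
  by rewrite mem_filter mem_enum andbT.
have esG' y x : ((y, x) \in swap_edges es) = cone (fun y x => G x y) y x.
  by rewrite mem_swap_edges esG; case: x y => [x|] [y|].
move=> /(hall_vector_cone esG)/left_degrees_tree[c' bc'].
have [c hc cE] := cone_hall_vector esG' (tree_left_degrees (tree_degrees_swap bc')).
by exists c => //; rewrite /hall_dual -cE.
Qed.

Lemma hall_dual_ex_sym (E F : finType) (G : E -> F -> bool) c :
  hall_vector (fun y x => G x y) c -> exists2 b, hall_vector G b & hall_dual G b c.
Proof.
set es := [seq p <- enum {: option E * option F} | cone G p.1 p.2].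
have esG x y : ((x, y) \in es) = cone G x y.
  by rewrite mem_filter mem_enum andbT.
have esG' y x : ((y, x) \in swap_edges es) = cone (fun y x => G x y) y x.
  by rewrite mem_swap_edges esG; case: x y => [x|] [y|].
move=> /(hall_vector_cone esG')/left_degrees_tree[b' /tree_degrees_swap].
have -> : swap_edges (swap_edges es) = es.
  by rewrite /swap_edges -map_comp map_id_in // => -[].
move=> cb'; have [b hb bE] := cone_hall_vector esG (tree_left_degrees cb').
by exists b => //; rewrite /hall_dual -bE.
Qed.

Lemma hall_dual_injl (E F : finType) (G : E -> F -> bool) b c c' :
  hall_dual G b c -> hall_dual G b c' -> c = c'.
Proof. by move=> h h'; apply/cone_degree_inj/(tree_degrees_det h h'). Qed.

Lemma hall_dual_injr (E F : finType) (G : E -> F -> bool) b b' c :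
  hall_dual G b c -> hall_dual G b' c -> b = b'.
Proof.
move=> /tree_degrees_swap h /tree_degrees_swap h'.
exact/cone_degree_inj/(tree_degrees_det h h').
Qed.

End DegreeDuality.

(** * Counting finite sets, and the duality for Hall vectors *)

Local Open Scope classical_set_scope.
Local Open Scope ring_scope.

(** Choice turns the relation into a map that is injective on [A]. *)
Lemma ncard_le_rel (T U : choiceType) (r : T -> U -> Prop) (A : set T)
    (B : set U) : finite_set B ->
  (forall x, A x -> exists2 y, B y & r x y) ->
  (forall x x' y, r x y -> r x' y -> x = x') -> (ncard A <= ncard B)%N.
Proof.
move=> finB AB rinj.
(* An infinite [A] has [ncard] equal to 0, and the inequality is trivial. *)
have [finA|infA] := pselect (finite_set A); last first.
  by rewrite /ncard /fset_set; case: pselect.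
have [A0|/set0P[x0 Ax0]] := eqVneq A set0.
  by rewrite A0 /ncard fset_set0 cardfs0.
have [y0 _ _] := AB _ Ax0.
have /choice[f fP] : forall x, exists y, A x -> B y /\ r x y.
  move=> x; have [/AB[y By rxy]|nA] := pselect (A x); first by exists y.
  by exists y0.
have -> : ncard A = #|` f @` fset_set A|%fset.
  rewrite card_in_imfset //= => x x'; rewrite !in_fset_set // !inE.
  by move=> /fP[_ rx] /fP[_ rx'] e; apply: rinj rx _; rewrite e.
apply/fsubset_leq_card/fsubsetP => y /imfsetP[x /=].
by rewrite !in_fset_set // !inE => /fP[? _] ->.
Qed.

Lemma ncard_image_inj (T U : choiceType) (f : T -> U) (A : set T) :
  injective f -> finite_set A -> ncard (f @` A) = ncard A.
Proof. by move=> injf finA; rewrite /ncard fset_set_image // card_imfset. Qed.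

Lemma finite_hall_vector (E F : finType) (G : E -> F -> bool) :
  finite_set [set b | hall_vector G b].
Proof.
pose g (f : {ffun E -> 'I_#|F|.+1}) : {ffun E -> nat} := [ffun e => f e : nat].
apply: (@sub_finite_set _ _ (g @` setT)); last exact: finite_image.
move=> b hb; exists [ffun e => inord (b e)] => //; apply/ffunP => e.
rewrite !ffunE inordK // ltnS; have := hb (finset.set1 e).
by rewrite big_set1 => /leq_trans; apply; apply: max_card.
Qed.

(* Postnikov's duality between the lattice points of two sums of simplices. *)
Lemma ncard_hall_vector (E F : finType) (G : E -> F -> bool) :
  ncard [set b | hall_vector G b] = ncard [set c | hall_vector (fun y x => G x y) c].
Proof.
apply/eqP; rewrite eqn_leq; apply/andP; split.
  apply: (ncard_le_rel (r := hall_dual G)) => [|b /hall_dual_ex//|b b' c].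
    exact: finite_hall_vector.
  exact: hall_dual_injr.
apply: (ncard_le_rel (r := fun c b => hall_dual G b c)).
- exact: finite_hall_vector.
- by move=> c /hall_dual_ex_sym.
- by move=> b b' c; apply: hall_dual_injl.
Qed.

(** * Lattice points of dilated polytopes as Hall vectors *)

Section IdealBounded.
Variables (R : realType) (E : finType).
Implicit Type tau : rel E.

Definition ideal_bounded tau (m : nat) (b : {ffun E -> nat}) : Prop :=
  forall I : {set E}, order_ideal tau I -> (\sum_(e in I) b e <= m * #|I|)%N.

Definition int_point (b : {ffun E -> nat}) : {ffun E -> int} :=
  [ffun e => (b e)%:Z].

Lemma int_point_inj : injective int_point.
Proof.
by move=> b b' /ffunP e; apply/ffunP => x; have := e x; rewrite !ffunE => -[].
Qed.

Lemma order_idealT tau : order_ideal tau (finset.setTfor E).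
Proof. by apply/'forall_forallP => ? ?; apply/implyP; rewrite inE. Qed.

Lemma lattice_points_dilate tau m :
  lattice_points (dilate m%:R (preorder_polytope R tau)) =
  int_point @` [set b | ideal_bounded tau m b].
Proof.
apply/seteqP; split => [a [x [x0 xI] /ffunP xa]|_ [b hb <-]] /=.
  have aE e : (a e)%:~R = m%:R * x e by have := xa e; rewrite !ffunE.
  have a0 e : 0 <= a e by rewrite -(ler0z R) aE mulr_ge0.
  exists [ffun e => `|a e|%N]; last by apply/ffunP => e; rewrite !ffunE gez0_abs.
  move=> I idI; rewrite -(ler_nat R) natr_sum natrM.
  under eq_bigr => e _ do rewrite ffunE pmulrn gez0_abs // aE.
  by rewrite -mulr_sumr ler_wpM2l // xI.
(* For [m = 0] the dilate is a single point and cannot be scaled back; the ideal of all elements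
   forces [b = 0]. *)
case: m hb => [|m] hb.
  exists [ffun=> 0]; last first.
    apply/ffunP => e; rewrite !ffunE mul0r.
    suff -> : b e = 0%N by [].
    apply/eqP; rewrite -leqn0; apply: leq_trans (hb _ (order_idealT tau)).
    by rewrite (bigD1 e) ?inE //= leq_addr.
  split=> [e|I _]; first by rewrite ffunE.
  by rewrite big1 // => e _; rewrite ffunE.
exists [ffun e => (b e)%:R / m.+1%:R]; last first.
  by apply/ffunP => e; rewrite !ffunE mulrCA divff ?mulr1 // pnatr_eq0.
split=> [e|I idI]; first by rewrite ffunE divr_ge0.
under eq_bigr do rewrite ffunE.
rewrite -mulr_suml ler_pdivrMr ?ltr0n // mulrC -natrM -natr_sum ler_nat.
exact: hb.
Qed.

Lemma preorder_pointsE tau :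
  preorder_points R tau = int_point @` [set b | ideal_bounded tau 1 b].
Proof.
rewrite -lattice_points_dilate /preorder_points; congr lattice_points.
apply/seteqP; split=> [x Qx|_ [x Qx <-]] /=.
  by exists x => //; apply/ffunP => e; rewrite ffunE mul1r.
by rewrite (_ : [ffun e => 1%:R * x e] = x) //; apply/ffunP => e; rewrite ffunE mul1r.
Qed.

(* With [m] copies of each element on the right, Hall's inequalities for the left
   side define the [m]-th dilate of the polytope of [tau], and those for the right
   side the increments of multichains of length [m] in the dual points. *)
Definition comparable_pair tau m (x : E) (y : E * 'I_m) : bool := tau y.1 x.

(** The neighbours of [U] are the [m] copies of the order ideal generated by [U], so the
    inequalities for ideals imply all the others. *)
Lemma ideal_bounded_hall tau m b : reflexive tau -> transitive tau ->
  ideal_bounded tau m b <-> hall_vector (@comparable_pair tau m) b.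
Proof.
move=> tau_refl tau_trans.
pose down (U : {set E}) := [set e | [exists f in U, tau e f]]%SET.
have cardN (U : {set E}) :
    #|[set y | [exists x in U, @comparable_pair tau m x y]]%SET| = (m * #|down U|)%N.
  rewrite -[m in RHS]card_ord mulnC -[X in (_ * X)%N]cardsT -cardsX.
  by apply: eq_card => -[e j]; rewrite !inE andbT.
split=> hb.
  move=> U; rewrite cardN.
  have dI : order_ideal tau (down U).
    apply/'forall_forallP => a c; apply/implyP; rewrite !inE => /andP[].
    move=> /exists_inP[f fU cf] ac; apply/exists_inP; exists f => //.
    exact: tau_trans cf.
  apply: leq_trans (hb _ dI); rewrite [leqRHS](bigID [in U]) /=.
  rewrite -[leqLHS]addn0 leq_add // [leqRHS]big_mkcond [leqLHS]big_mkcond /=.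
  apply: leq_sum => e _; case: ifP => // eU; rewrite inE andbT.
  by rewrite ifT //; apply/exists_inP; exists e.
move=> I idI; apply: leq_trans (hb I) _; rewrite cardN leq_mul2l.
apply/orP; right; apply/subset_leq_card/fintype.subsetP => e; rewrite inE.
move=> /exists_inP[f fI ef]; move/'forall_forallP: idI => /(_ e f).
by rewrite fI ef.
Qed.

Definition row_sum m (c : {ffun E * 'I_m -> nat}) : {ffun E -> nat} :=
  [ffun e => \sum_j c (e, j)]%N.

(** Among the sets with a given neighbourhood [N], which is an ideal of the dual, the strongest
    inequality is that of all pairs with first component in [N], and its left-hand side is a sum of
    row sums. *)
Lemma row_sum_hall tau m c : reflexive tau -> transitive tau ->
  hall_vector (fun y x => @comparable_pair tau m x y) c <->
  ideal_bounded (dual_rel tau) 1 (row_sum c).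
Proof.
move=> tau_refl tau_trans.
have sumE (I : {set E}) : (\sum_(e in I) row_sum c e = \sum_(y | y.1 \in I) c y)%N.
  under eq_bigr do rewrite ffunE.
  by rewrite pair_big_dep /=; apply: eq_big => [[e j]|[e j]] //=; rewrite andbT.
split=> hc.
  move=> I idI; rewrite sumE mul1n.
  have := hc [set y | y.1 \in I]%SET.
  rewrite (eq_bigl (fun y => y.1 \in I)) => [/leq_trans->//|y]; last by rewrite inE.
  apply/subset_leq_card/fintype.subsetP => e; rewrite inE.
  move=> /exists_inP[[f j]]; rewrite inE /comparable_pair /= => fI fe.
  by move/'forall_forallP: idI => /(_ e f); rewrite fI /dual_rel fe.
move=> U; pose N := [set x | [exists y in U, @comparable_pair tau m x y]]%SET.
rewrite -/N.
have idN : order_ideal (dual_rel tau) N.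
  apply/'forall_forallP => a b; apply/implyP; rewrite !inE => /andP[].
  move=> /exists_inP[y yU yb] ba; apply/exists_inP; exists y => //.
  by apply: tau_trans yb ba.
have := hc N idN; rewrite mul1n sumE; apply: leq_trans.
rewrite [leqRHS]big_mkcond [leqLHS]big_mkcond /=.
apply: leq_sum => y _; case: ifP => // yU; rewrite ifT // inE.
by apply/exists_inP; exists y => //; apply: tau_refl.
Qed.

Lemma ncard_lattice_points tau m : reflexive tau -> transitive tau ->
  ncard (lattice_points (dilate m%:R (preorder_polytope R tau))) =
  ncard [set c | ideal_bounded (dual_rel tau) 1 (@row_sum m c)].
Proof.
move=> tau_refl tau_trans; rewrite lattice_points_dilate ncard_image_inj.
- rewrite (_ : [set b | _] = [set b | hall_vector (@comparable_pair tau m) b]).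
    rewrite ncard_hall_vector; congr ncard; apply/seteqP.
    by split=> c; apply row_sum_hall.
  by apply/seteqP; split=> b; apply ideal_bounded_hall.
- exact: int_point_inj.
- rewrite (_ : [set b | _] = [set b | hall_vector (@comparable_pair tau m) b]).
    exact: finite_hall_vector.
  by apply/seteqP; split=> b; apply ideal_bounded_hall.
Qed.

End IdealBounded.

Lemma ideal_bounded_le (E : finType) (tau : rel E) m (a b : {ffun E -> nat}) :
  (forall e, (a e <= b e)%N) -> ideal_bounded tau m b -> ideal_bounded tau m a.
Proof.
by move=> ab hb I idI; apply: leq_trans (hb I idI); apply: leq_sum.
Qed.

Lemma finite_row_sum (E : finType) (tau : rel E) m :
  reflexive tau -> transitive tau ->
  finite_set [set c | ideal_bounded (dual_rel tau) 1 (@row_sum E m c)].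
Proof.
move=> tau_refl tau_trans.
rewrite (_ : [set c | _] =
  [set c | hall_vector (fun y x => @comparable_pair E tau m x y) c]).
  exact: finite_hall_vector.
by apply/seteqP; split=> c; apply row_sum_hall.
Qed.

(** * Multichains as arrays of increments *)

Section PartialSums.
Variables (E : finType) (m : nat).
Implicit Type c : {ffun E * 'I_m -> nat}.

Definition partial_sum c (k : nat) : {ffun E -> nat} :=
  [ffun e => \sum_(i < m | i < k) c (e, i)]%N.

Definition chain_of c : m.-tuple {ffun E -> int} :=
  [tuple int_point (partial_sum c j.+1) | j < m].

Lemma chain_of_inj : injective chain_of.
Proof.
move=> c c' cc'; apply/ffunP => -[e j].
have [k] := ubnP (j : nat); elim: k j => // k IH j; rewrite ltnS => jk.
have := congr1 (fun p : m.-tuple {ffun E -> int} => tnth p j e) cc'.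
rewrite !tnth_mktuple !ffunE => -[].
rewrite (bigD1 j) //= [in RHS](bigD1 j) //= => /eqP.
rewrite (eq_bigr (fun i => c' (e, i))) ?eqn_add2r; first by move=> /eqP.
move=> i /andP[ij nij]; apply: IH; apply: leq_trans jk.
by rewrite ltn_neqAle nij.
Qed.

Lemma partial_sum_le c k e : (partial_sum c k e <= row_sum c e)%N.
Proof. by rewrite !ffunE big_mkcond; apply: leq_sum => i _; case: ifP. Qed.

Lemma partial_sum_mono c k e : (partial_sum c k e <= partial_sum c k.+1 e)%N.
Proof.
rewrite !ffunE big_mkcond [leqRHS]big_mkcond; apply: leq_sum => i _.
by case: ifP => // /ltnW; rewrite -ltnS => ->.
Qed.

(** The terms of a multichain are the partial sums of its increments. All of them lie below the row
    sums, and [ideal_bounded] passes to smaller vectors, so only the last term has to be tested. *)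
Lemma multichains_row_sum (R : realType) (tau : rel E) :
  multichains cw_le (preorder_points R tau) m =
  chain_of @` [set c | ideal_bounded tau 1 (@row_sum E m c)].
Proof.
pose x0 : {ffun E -> int} := [ffun=> 0].
apply/seteqP; split=> [p [pP psort]|_ [c hc <-]] /=; last first.
  split=> [j|].
    rewrite tnth_mktuple preorder_pointsE; exists (partial_sum c j.+1) => //.
    by apply: ideal_bounded_le hc => e; apply: partial_sum_le.
  apply/(sortedP x0) => i; rewrite size_tuple => im.
  have -> : nth x0 (chain_of c) i = tnth (chain_of c) (Ordinal (ltnW im)).
    by rewrite (tnth_nth x0).
  have -> : nth x0 (chain_of c) i.+1 = tnth (chain_of c) (Ordinal im).
    by rewrite (tnth_nth x0).
  rewrite !tnth_mktuple; apply/forallP => e; rewrite !ffunE lez_nat.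
  by have := partial_sum_mono c i.+1 e; rewrite !ffunE.
have pN (j : 'I_m) : exists2 b, ideal_bounded tau 1 b & tnth p j = int_point b.
  by have := pP j; rewrite preorder_pointsE => -[b hb <-]; exists b.
(* The chain is preceded by the zero vector, so that its first increment is its first term. *)
pose q k e := if k is k'.+1 then `|nth x0 p k' e|%N else 0%N.
have qE (j : 'I_m) e : tnth p j e = q j.+1 e.
  rewrite /q -(tnth_nth x0); have [b _ ->] := pN j.
  by rewrite ffunE.
have q_mono k e : (k < m)%N -> (q k e <= q k.+1 e)%N.
  case: k => // k km; have km' := ltnW km.
  rewrite -lez_nat -(qE (Ordinal km)) -(qE (Ordinal km')) !(tnth_nth x0).
  by move/(sortedP x0): psort => /(_ k); rewrite size_tuple => /(_ km)/forallP.
pose c : {ffun E * 'I_m -> nat} := [ffun y : E * 'I_m => q y.2.+1 y.1 - q y.2 y.1]%N.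
have cq k e : (k <= m)%N -> partial_sum c k e = q k e.
  move=> km; rewrite ffunE.
  under eq_bigr do rewrite ffunE /=.
  rewrite -(big_ord_widen _ (fun i => q i.+1 e - q i e)%N) //.
  rewrite -(big_mkord xpredT (fun i => q i.+1 e - q i e)%N) telescope_sumn_in //.
    by rewrite subn0.
  by move=> i /andP[_ ik]; apply: q_mono; apply: leq_trans km.
exists c; last first.
  apply: eq_from_tnth => j; rewrite tnth_mktuple; apply/ffunP => e.
  by rewrite qE ffunE cq.
have -> : row_sum c = partial_sum c m.
  by apply/ffunP => e; rewrite !ffunE; apply: eq_bigl => i; rewrite ltn_ord.
have [m0|m_gt0] := posnP m.
  move=> I _; rewrite big1 // => e _; rewrite ffunE big1 // => i _.
  by have := ltn_ord i; lia.
have km : (m.-1 < m)%N by rewrite prednK.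
have [b hb bE] := pN (Ordinal km); apply: ideal_bounded_le hb => e.
rewrite cq // -lez_nat.
have qm : q (Ordinal km).+1 e = q m e by congr (q _ e); apply: prednK.
by have := qE (Ordinal km) e; rewrite bE ffunE qm => ->.
Qed.

Lemma ncard_multichains (R : realType) (tau : rel E) :
  reflexive tau -> transitive tau ->
  ncard (multichains cw_le (preorder_points R (dual_rel tau)) m) =
  ncard [set c | ideal_bounded (dual_rel tau) 1 (@row_sum E m c)].
Proof.
move=> tau_refl tau_trans; rewrite multichains_row_sum ncard_image_inj //.
  exact: chain_of_inj.
exact: finite_row_sum.
Qed.

End PartialSums.

(** * Arrays with given row sums and binomial polynomials *)

Lemma ncard_finType (T : finType) (P : pred T) : ncard [set x | P x] = #|P|.
Proof.
have finP : finite_set [set x | P x] by exact: finite_finset.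
rewrite /ncard -(card_uniqP (fset_uniq _)); apply: eq_card => x.
by rewrite in_fset_set //; apply/idP/idP; rewrite !inE.
Qed.

Definition weak_compositions (m k : nat) : nat :=
  if m is m'.+1 then 'C(m' + k, k) else (k == 0%N).

(** The bound [N] on the parts is left free so that a single finite type serves rows with different
    sums. *)
Lemma card_weak_compositions m k N : (k <= N)%N ->
  (\sum_(s : m.-tuple 'I_N.+1) (\sum_(i < m) tnth s i == k) =
   weak_compositions m k)%N.
Proof.
move=> kN; case: m => [|m] /=.
  rewrite (big_pred1 [tuple]) => [|s]; first by rewrite big_ord0 eq_sym.
  by rewrite [s]tuple0 /= eqxx.
have -> : 'C(m + k, k) = 'C(m + k, m).
  by have := bin_sub (leq_addr k m); rewrite addKn.
rewrite -card_ord_partitions.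
pose h (t : m.+1.-tuple 'I_k.+1) : m.+1.-tuple 'I_N.+1 :=
  [tuple inord (tnth t i) | i < m.+1].
have hE t i : tnth (h t) i = tnth t i :> nat.
  by rewrite tnth_mktuple inordK // (leq_trans (ltn_ord _)).
have injh : injective h.
  move=> t t' tt; apply: eq_from_tnth => i; apply: val_inj.
  by rewrite /= -!hE tt.
rewrite -(card_imset _ injh) -sum1_card big_mkcond [RHS]big_mkcond /=.
apply: eq_bigr => s _; set b := (_ == k).
suff -> : (s \in imset h (mem
    [set t : m.+1.-tuple 'I_k.+1 | (\sum_(i <- t) i == k)%N]%SET)) = b.
  by case: b.
apply/imsetP/eqP => [[t]|sk].
  by rewrite inE big_tuple => /eqP tk ->; under eq_bigr do rewrite hE.
have sik i : (tnth s i < k.+1)%N.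
  by rewrite ltnS -sk (bigD1 i) //= leq_addr.
exists [tuple inord (tnth s i) | i < m.+1].
  rewrite inE big_tuple; apply/eqP; rewrite -[RHS]sk; apply: eq_bigr => i _.
  by rewrite tnth_mktuple inordK.
apply: eq_from_tnth => i; apply: val_inj.
by rewrite /= hE tnth_mktuple inordK.
Qed.

Lemma binomp_weak_compositions (m k : nat) :
  (binomp ('X + (k%:R)%:P - 1) k).[m%:R] = (weak_compositions m k)%:R.
Proof.
rewrite /binomp hornerZ horner_prod.
have k0 : (k`!)%:R != 0 :> rat by rewrite pnatr_eq0 -lt0n fact_gt0.
apply: (mulfI k0); rewrite mulrA divff // mul1r -natrM.
have evalE i : ('X + (k%:R)%:P - 1 - i%:R : {poly rat}).[m%:R] =
    m%:R + k%:R - 1 - i%:R.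
  by rewrite -(polyC_natr rat i) !hornerE.
under eq_bigr do rewrite evalE.
case: m {evalE} => [|m] /=.
  (* At [m = 0] and positive [k] the last factor of the product is zero. *)
  case: k {k0} => [|k]; first by rewrite big_ord0.
  by rewrite big_ord_recr /= add0r -natr1 addrK subrr mulr0 muln0.
rewrite mulnC bin_ffact ffact_prod natr_prod; apply: eq_bigr => i _.
rewrite natrB; last by rewrite (leq_trans (ltnW (ltn_ord i))) ?leq_addl.
by rewrite natrD -natr1 (addrAC _ 1) addrK.
Qed.

Lemma prod_nat_bool (E : finType) (P : pred E) :
  (\prod_e P e = [forall e, P e])%N.
Proof.
have [/forallP Pe|/forallPn[e nPe]] := boolP [forall e, P e].
  by rewrite big1 // => e _; rewrite Pe.
by rewrite (bigD1 e) //= (negPf nPe) mul0n.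
Qed.

(** Once the row sums are prescribed, the rows are independent weak compositions, whence the
    product. Row sums are at most [#|E|], by the ideal of all elements, so the arrays can range over
    a finite type. *)
Lemma ncard_row_sum (E : finType) (tau : rel E) m (s : seq {ffun E -> int}) :
  uniq s ->
  (forall a, (a \in s) <-> exists2 b, ideal_bounded tau 1 b & a = int_point b) ->
  ncard [set c | ideal_bounded tau 1 (@row_sum E m c)] =
  (\sum_(a <- s) \prod_e weak_compositions m `|a e|)%N.
Proof.
move=> us sP; pose n := #|E|.
pose W := {ffun E -> m.-tuple 'I_n.+1}.
pose sums (t : W) : {ffun E -> nat} := [ffun e => \sum_(i < m) tnth (t e) i]%N.
pose h (t : W) : {ffun E * 'I_m -> nat} := [ffun y => tnth (t y.1) y.2 : nat].
have injh : injective h.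
  move=> t t' /ffunP tt; apply/ffunP => e; apply: eq_from_tnth => i.
  by apply: val_inj; have := tt (e, i); rewrite !ffunE.
have row_h t : row_sum (h t) = sums t.
  by apply/ffunP => e; rewrite !ffunE; apply: eq_bigr => i _; rewrite ffunE.
have bound b e : ideal_bounded tau 1 b -> (b e <= n)%N.
  move=> /(_ _ (order_idealT tau)); rewrite mul1n cardsT; apply: leq_trans.
  by rewrite (bigD1 e) ?inE //= leq_addr.
pose X (t : W) := int_point (sums t) \in s.
have -> : [set c | ideal_bounded tau 1 (@row_sum E m c)] = h @` [set t | X t].
  apply/seteqP; split=> [c hc|_ [t /sP[b hb /int_point_inj tb] <-]] /=; last first.
    by rewrite row_h tb.
  have cn e i : (c (e, i) < n.+1)%N.
    rewrite ltnS; apply: leq_trans (bound _ e hc).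
    by rewrite ffunE (bigD1 i) //= leq_addr.
  pose t : W := [ffun e => [tuple inord (c (e, i)) | i < m]].
  have htc : h t = c.
    by apply/ffunP => -[e i]; rewrite !ffunE tnth_mktuple inordK.
  by exists t => //; apply/sP; exists (row_sum c) => //; rewrite -row_h htc.
rewrite ncard_image_inj // ?ncard_finType; last exact: finite_finset.
rewrite -sum1_card big_mkcond /=.
transitivity (\sum_(t : W) \sum_(a <- s) (int_point (sums t) == a))%N.
  apply: eq_bigr => t _; rewrite -[LHS]/(X t : nat) /X.
  rewrite -count_uniq_mem // -sum1_count big_mkcond.
  by apply: eq_bigr => a _; rewrite eq_sym /=; case: eqP.
rewrite exchange_big /=; apply: eq_big_seq => a /sP[b hb ->].
(* By distributivity, an array with prescribed row sums is one choice of a row for each element. *)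
transitivity (\prod_e \sum_(u : m.-tuple 'I_n.+1) (\sum_(i < m) tnth u i == b e))%N.
  rewrite bigA_distr_bigA; apply: eq_bigr => t _; rewrite prod_nat_bool.
  congr nat_of_bool; apply/eqP/forallP => [/int_point_inj <- e|tb].
    by rewrite ffunE.
  by congr int_point; apply/ffunP => e; rewrite ffunE; apply/eqP.
by apply: eq_bigr => e _; rewrite card_weak_compositions ?ffunE // bound.
Qed.

(** * Degrees and leading coefficients of the binomial products *)

Lemma binomp_prodE (k : nat) :
  binomp ('X + (k%:R)%:P - 1) k =
  (k`!)%:R^-1 *: \prod_(c <- [seq i%:R + 1 - k%:R | i <- iota 0 k]) ('X - c%:P).
Proof.
rewrite /binomp big_map -(subn0 k) -/(index_iota 0 k) big_mkord subn0.
congr (_ *: _); apply: eq_bigr => i _.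
by rewrite !polyCD polyCN !polyC_natr !opprD opprK; ring.
Qed.

Lemma fact_ratr_neq0 (k : nat) : (k`!)%:R != 0 :> rat.
Proof. by rewrite pnatr_eq0 -lt0n fact_gt0. Qed.

Lemma size_binomp (k : nat) : size (binomp ('X + (k%:R)%:P - 1) k) = k.+1.
Proof.
rewrite binomp_prodE size_scale ?invr_eq0 ?fact_ratr_neq0 //.
by rewrite size_prod_XsubC size_map size_iota.
Qed.

Lemma lead_coef_binomp (k : nat) :
  lead_coef (binomp ('X + (k%:R)%:P - 1) k) = (k`!)%:R^-1.
Proof.
rewrite binomp_prodE lead_coefZ (monicP _) ?mulr1 //.
exact: monic_prod_XsubC.
Qed.

Lemma size_prod_binomp (E : finType) (b : {ffun E -> nat}) :
  size (\prod_e binomp ('X + ((b e)%:R)%:P - 1) (b e)) = (\sum_e b e).+1.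
Proof.
rewrite size_prod => [|e _]; last by rewrite -size_poly_gt0 size_binomp.
under eq_bigr do rewrite size_binomp -addn1.
by rewrite big_split /= sum_nat_const muln1 -addSn addnK.
Qed.

Lemma coef_prod_binomp (E : finType) (b : {ffun E -> nat}) n :
  (\sum_e b e <= n)%N ->
  (\prod_e binomp ('X + ((b e)%:R)%:P - 1) (b e))`_n =
  (\sum_e b e == n)%:R * \prod_e ((b e)`!)%:R^-1.
Proof.
move=> bn; have [<-|ne] := eqVneq; last first.
  by rewrite mul0r nth_default // size_prod_binomp ltn_neqAle ne.
rewrite mul1r -[X in _`_X]/((\sum_e b e).+1.-1) -size_prod_binomp -lead_coefE.
by rewrite lead_coef_prod; apply: eq_bigr => e _; rewrite lead_coef_binomp.
Qed.

(** * Words and multinomial coefficients *)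

Section Words.
Variable E : finType.

Definition word_content (w : seq E) : {ffun E -> nat} := [ffun e => count_mem
    e w].

Definition remove_letter (b : {ffun E -> nat}) (e : E) : {ffun E -> nat} :=
  [ffun x => b x - (x == e)]%N.

Lemma sum_word_content (w : seq E) (I : {set E}) :
  (\sum_(e in I) word_content w e = count [in I] w)%N.
Proof.
elim: w => [|x w IH] /=.
  by rewrite big1 // => e _; rewrite ffunE.
rewrite -IH; under eq_bigr do rewrite ffunE /=.
rewrite big_split /=; congr (_ + _)%N; last by apply: eq_bigr => e _; rewrite ffunE.
case xI: (x \in I).
  by rewrite (bigD1 x) //= eqxx big1 // => e /andP[_]; rewrite eq_sym => /negPf ->.
by rewrite big1 // => e eI; case: eqP => // xe; rewrite xe eI in xI.
Qed.

Lemma word_content_cons (x : E) (w : seq E) (b : {ffun E -> nat}) :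
  (word_content (x :: w) == b) = (0 < b x)%N && (word_content w == remove_letter b x).
Proof.
apply/eqP/andP => [<-|[bx /eqP/ffunP cw]].
  rewrite ffunE /= eqxx; split=> //; apply/eqP/ffunP => e.
  by rewrite !ffunE /= eq_sym; lia.
apply/ffunP => e; have := cw e; rewrite !ffunE /= (eq_sym e).
by case: (eqVneq x e) bx => [->|_]; lia.
Qed.

Lemma sum_tuple_cons (n : nat) (F : n.+1.-tuple E -> nat) :
  (\sum_(w : n.+1.-tuple E) F w =
   \sum_(x : E) \sum_(w : n.-tuple E) F [tuple of x :: w])%N.
Proof.
rewrite pair_big /= (reindex (fun p : E * n.-tuple E => [tuple of p.1 :: p.2])) //=.
exists (fun w : n.+1.-tuple E => (thead w, [tuple of behead w])).
  by move=> [x w] _ /=; congr pair; apply: val_inj.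
by move=> w _; rewrite /= -tuple_eta.
Qed.

(** Words are sorted by their first letter [x]: removing it divides the product of factorials by
    [b x], and the numbers [b x] add up to the length. *)
Lemma multinomial_count (n : nat) (b : {ffun E -> nat}) :
  (\sum_e b e = n)%N ->
  ((\sum_(w : n.-tuple E) (word_content w == b)) * \prod_e (b e)`! = n`!)%N.
Proof.
elim: n b => [|n IH] b bn.
  have b0 e : b e = 0%N.
    by apply/eqP; rewrite -leqn0 -bn (bigD1 e) //= leq_addr.
  rewrite [X in (_ * X)%N]big1 => [|e _]; last by rewrite b0.
  rewrite (big_pred1 [tuple]) => [|w]; last by rewrite [w]tuple0 /= eqxx.
  rewrite (_ : word_content _ = b) ?eqxx //.
  by apply/ffunP => e; rewrite ffunE b0.
rewrite sum_tuple_cons big_distrl /= factS -bn big_distrl /=.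
apply: eq_bigr => x _; under eq_bigr do rewrite word_content_cons.
have [bx|bx] := posnP (b x).
  by rewrite bx mul0n big1.
have rx : remove_letter b x x = (b x).-1 by rewrite ffunE eqxx subn1.
have rne e : e != x -> remove_letter b x e = b e.
  by move=> /negPf ne; rewrite ffunE ne subn0.
have sr : (\sum_e remove_letter b x e = n)%N.
  move: bn; rewrite (bigD1 x) //=.
  rewrite (bigD1 x (P := xpredT) (F := remove_letter b x)) //= rx.
  have -> : (\sum_(e | e != x) remove_letter b x e = \sum_(e | e != x) b e)%N.
    by apply: eq_bigr => e ne; rewrite rne.
  by lia.
rewrite -[X in (_ * X)%N = _](_ : b x * \prod_e (remove_letter b x e)`! = _)%N.
  by rewrite mulnCA IH.
rewrite (bigD1 x) //= [RHS](bigD1 x) //= rx mulnA.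
congr (_ * _)%N; first by case: (b x) bx.
by apply: eq_bigr => e ne; rewrite rne.
Qed.

End Words.

(** Complements of ideals are ideals of the dual, and as the word has length [#|E|], a lower bound
    on its letters in [I] is an upper bound on those outside. *)
Lemma ideal_wordE (E : finType) (tau : rel E) (w : #|E|.-tuple E) :
  ideal_word tau #|E| w <-> ideal_bounded (dual_rel tau) 1 (word_content w).
Proof.
have idC (I : {set E}) : order_ideal tau I -> order_ideal (dual_rel tau) (finset.setC I).
  move=> /'forall_forallP idI; apply/'forall_forallP => a b; apply/implyP.
  rewrite !inE => /andP[bI ba]; apply: contra bI => aI.
  by have /implyP := idI b a; rewrite aI => /(_ ba).
have idC' (I : {set E}) : order_ideal (dual_rel tau) I -> order_ideal tau (finset.setC I).
  move=> /'forall_forallP idI; apply/'forall_forallP => a b; apply/implyP.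
  rewrite !inE => /andP[bI ba]; apply: contra bI => aI.
  by have /implyP := idI b a; rewrite aI => /(_ ba).
have cnt (I : {set E}) :
    (count [in I] w + \sum_(e in finset.setC I) word_content w e = #|E|)%N.
  rewrite sum_word_content -[RHS](size_tuple w) -(count_predC [in I] w); congr (_ + _)%N.
  by apply: eq_count => x; rewrite /= inE.
have crd (I : {set E}) := cardsC I.
split=> [/forallP hw|hw].
  move=> I idI; have /implyP/(_ (idC' I idI)) := hw (finset.setC I).
  by have := cnt (finset.setC I); have := crd I; rewrite finset.setCK; lia.
apply/forallP => I; apply/implyP => idI.
by have := hw _ (idC I idI); have := cnt I; have := crd I; lia.
Qed.

(** A negative coefficient would be the leading one, and [q] would become negative at large
    integers. *)
Lemma coef_ge0 (R : realType) (q : {poly R}) (n : nat) :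
  (size q <= n.+1)%N -> (forall m : nat, 0 <= q.[m.+1%:R]) -> 0 <= q`_n.
Proof.
move=> sq q0; rewrite leNgt; apply/negP => qn.
have sqE : size q = n.+1.
  apply/eqP; rewrite eqn_leq sq ltnNge; apply/negP => /(nth_default 0) e.
  by rewrite e ltxx in qn.
have lc : 0 < lead_coef (- q) by rewrite lead_coefN oppr_gt0 lead_coefE sqE.
have [x xP] := polyrcf.poly_pinfty_gt_lc lc.
have := xP (Num.trunc x).+1%:R (ltW (truncnS_gt x)).
by rewrite hornerN leNgt (le_lt_trans _ lc) // oppr_le0.
Qed.

(** * Lebesgue measure on tuples as a product measure *)

Section SigmaFiniteMeasure.
Context d (T : measurableType d) (R : realType).
Context (mu : {measure set T -> \bar R}) (sf : sigma_finite setT mu).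

(** An alias of [mu] that mentions the proof [sf], so that the sigma-finite structure can be
    attached to a measure for which sigma-finiteness is only a hypothesis. *)
Definition sigma_finite_of (_ : sigma_finite setT mu) : set T -> \bar R := mu.

HB.instance Definition _ := Measure.copy (sigma_finite_of sf) mu.

HB.instance Definition _ :=
  Measure_isSigmaFinite.Build d T R (sigma_finite_of sf) sf.

End SigmaFiniteMeasure.

Section Boxes.
Variable R : realType.

Definition half_open_box n (a : 'I_n -> R) (h : R) : set (n.-tuple R) :=
  [set t | forall i, a i <= tnth t i < a i + h].

Lemma measurable_half_open_box n (a : 'I_n -> R) h :
  measurable (half_open_box a h).
Proof.
rewrite (_ : half_open_box a h =
    \bigcap_(i in setT) ((fun t => tnth t i) @^-1` `[a i, a i + h[)).
  apply: fin_bigcap_measurable => // i _.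
  by rewrite -[X in measurable X]setTI; apply: measurable_tnth.
apply/seteqP; split=> t /= ht i; first by move=> _ /=; rewrite in_itv /= ht.
by have := ht i I; rewrite /= in_itv.
Qed.

Lemma sigma_finite_lebesgue_tuple n
    (mu : {measure set (n.-tuple R) -> \bar R}) :
  (mu : set (n.-tuple R) -> \bar R) = @lebesgue_tuple R n ->
  sigma_finite setT mu.
Proof.
move=> muE.
pose F k : set (n.-tuple R) := [set t | forall i, - k%:R <= tnth t i <= k%:R].
exists F.
  apply/seteqP; split=> // t _.
  pose M := \sum_(i < n) `|tnth t i|.
  have [k Mk] : exists k : nat, M <= k%:R.
    by exists (Num.trunc M).+1; apply/ltW/truncnS_gt.
  exists k => // i; rewrite -ler_norml; apply: le_trans Mk.
  by rewrite /M (bigD1 i) //= lerDl sumr_ge0.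
move=> k; split.
  rewrite (_ : F k = \bigcap_(i in setT)
      ((fun t => tnth t i) @^-1` `[- k%:R, k%:R])).
    apply: fin_bigcap_measurable => // i _.
    by rewrite -[X in measurable X]setTI; apply: measurable_tnth.
  apply/seteqP; split=> t /= ht i; first by move=> _ /=; rewrite in_itv /= ht.
  by have := ht i I; rewrite /= in_itv.
rewrite muE /F lebesgue_tuple_box ?ltry // => i.
by rewrite (@le_trans _ _ 0) // oppr_le0.
Qed.

(** The recursion defines a mere set function. That it is a measure goes through the induction
    together with sigma-finiteness, which forming the next product measure needs. *)
Lemma lebesgue_tuple_measure n :
  exists mu : {sigma_finite_measure set (n.-tuple R) -> \bar R},
    (mu : set (n.-tuple R) -> \bar R) = @lebesgue_tuple R n.
Proof.
elim: n => [|n [mu muE]].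
  by exists (\d_ ([tuple] : 0.-tuple R)).
pose f (p : R * n.-tuple R) := [tuple of p.1 :: p.2].
have mf : measurable_fun setT f by apply: measurable_cons.
pose nu : {measure set (n.+1.-tuple R) -> \bar R} :=
  measure_function_pushforward__canonical__measure_function_Measure
    (lebesgue_measure \x mu)%E mf.
have nuE : (nu : set (n.+1.-tuple R) -> \bar R) = @lebesgue_tuple R n.+1.
  by rewrite /nu /= muE.
by exists (sigma_finite_of (sigma_finite_lebesgue_tuple nuE)).
Qed.

Lemma lebesgue_tuple_half_open_box n (a : 'I_n -> R) h : 0 < h ->
  @lebesgue_tuple R n (half_open_box a h) = (h ^+ n)%:E.
Proof.
move=> h0; elim: n a => [|n IH] a.
  by rewrite /= diracE mem_set // => -[].
have [mu muE] := lebesgue_tuple_measure n.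
pose b i := a (lift ord0 i).
have lam : lebesgue_measure (`[a ord0, a ord0 + h[ : set R) = h%:E.
  rewrite lebesgue_measure_itv /= lte_fin ltrDl h0 -EFinD.
  by rewrite (addrAC (a ord0)) subrr add0r.
have := @product_measure1E _ _ _ _ R lebesgue_measure mu `[a ord0, a ord0 + h[
  (half_open_box b h) (measurable_itv _) (measurable_half_open_box _ _).
rewrite muE IH => prodE; transitivity (h%:E * (h ^+ n)%:E)%E; last first.
  by rewrite -EFinM -exprS.
rewrite -{1}lam -prodE.
rewrite /pushforward; congr product_measure1; apply/seteqP; split=> -[x t] /=.
  move=> ht; split=> /=; first by have := ht ord0; rewrite tnth0 in_itv.
  by move=> i; have := ht (lift ord0 i); rewrite tnthS.
move=> [/= xa ht] i; have [j ->|->] := unliftP ord0 i; first by rewrite tnthS ht.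
by rewrite tnth0; move: xa; rewrite in_itv.
Qed.

End Boxes.

(** * Volume of the polytope between two counts of cubes *)

Section PolytopeVolume.
Variables (R : realType) (E : finType) (tau : rel E).

Let n := #|E|.
Let point (t : n.-tuple R) : {ffun E -> R} := [ffun e => tnth t (enum_rank e)].
Let Q := point @^-1` preorder_polytope R tau.

Let measurable_le (f : n.-tuple R -> R) (c : R) :
  measurable_fun setT f -> measurable [set t | f t <= c].
Proof.
move=> mf; rewrite (_ : [set t | _] = f @^-1` `]-oo, c]).
  by rewrite -[X in measurable X]setTI; apply: mf.
by apply/seteqP; split=> t /=; rewrite in_itv.
Qed.

Lemma measurable_polytope : measurable Q.
Proof.
have sumE t (I : {set E}) :
    \sum_(e in I) point t e = \sum_(e in I) tnth t (enum_rank e).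
  by apply: eq_bigr => e _; rewrite ffunE.
rewrite (_ : Q = (\bigcap_(e in setT) [set t | - tnth t (enum_rank e) <= 0])
   `&` \bigcap_(I in [set I | order_ideal tau I])
         [set t | \sum_(e in I) tnth t (enum_rank e) <= #|I|%:R]).
  apply: measurableI; apply: fin_bigcap_measurable => //.
    move=> e _; apply: measurable_le; apply: measurableT_comp => //.
    exact: measurable_tnth.
  move=> I _; apply: measurable_le.
  under eq_fun do rewrite -big_enum.
  by apply: measurable_sum => e; apply: measurable_tnth.
apply/seteqP; split=> t /=.
  move=> [t0 tI]; split=> [e _ /=|I idI /=].
    by rewrite oppr_le0; have := t0 e; rewrite ffunE.
  by rewrite -sumE; apply: tI.
move=> [t0 tI]; split=> [e|I idI].
  by have := t0 e; rewrite ffunE /= oppr_le0; apply.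
by rewrite sumE; apply: tI.
Qed.

Let cube (h : R) (b : {ffun E -> nat}) : set (n.-tuple R) :=
  half_open_box (fun i => (b (enum_val i))%:R * h) h.

Let cubeP h b t : cube h b t <->
  forall e, (b e)%:R * h <= tnth t (enum_rank e) < (b e).+1%:R * h.
Proof.
split=> ht.
  by move=> e; have := ht (enum_rank e); rewrite enum_rankK -natr1 mulrDl mul1r.
move=> i; have := ht (enum_val i).
by rewrite enum_valK -natr1 mulrDl mul1r.
Qed.

Let measure_cubes (mu : {measure set (n.-tuple R) -> \bar R}) h
    (A : set {ffun E -> nat}) :
  (mu : set (n.-tuple R) -> \bar R) = @lebesgue_tuple R n ->
  0 < h -> finite_set A ->
  mu (\bigcup_(b in A) cube h b) = ((ncard A)%:R * h ^+ n)%:E.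
Proof.
move=> muE h0 finA.
have cubeE b : mu (cube h b) = (h ^+ n)%:E.
  by rewrite muE lebesgue_tuple_half_open_box.
rewrite -bigsetU_fset_set // measure_fbigsetU.
- rewrite (eq_bigr (fun=> (h ^+ n)%:E)) => [|b _]; last exact: cubeE.
  by rewrite sumEFin big_const_seq count_predT iter_addr_0 mulr_natl.
- by move=> b _; apply: measurable_half_open_box.
(* The index of a cube is recovered from any of its points as the integer parts of the coordinates
   divided by [h], so distinct cubes are disjoint. *)
move=> b b' _ _ [t [/cubeP hb /cubeP hb']]; apply/ffunP => e.
have trunc_eq (c : {ffun E -> nat}) :
    (c e)%:R * h <= tnth t (enum_rank e) < (c e).+1%:R * h ->
    Num.truncn (tnth t (enum_rank e) / h) = c e.
  by move=> ?; apply: truncn_def; rewrite ler_pdivlMr // ltr_pdivrMr.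
by rewrite -(trunc_eq b) // -(trunc_eq b').
Qed.

(* The cubes of side [1 / (m + 1)] meeting the polytope are among those with
   lowest corner in it, and the one at [b / (m + 1)] is inside as soon as [b] is
   in the [m]-th dilate. *)
Lemma volume_polytope_bounds m :
  finite_set [set b | ideal_bounded tau m b] ->
  finite_set [set b | ideal_bounded tau m.+1 b] ->
  (((ncard [set b | ideal_bounded tau m b])%:R * m.+1%:R^-1 ^+ n)%:E <=
    volume (preorder_polytope R tau) <=
   ((ncard [set b | ideal_bounded tau m.+1 b])%:R * m.+1%:R^-1 ^+ n)%:E)%E.
Proof.
move=> fin fin'; pose h : R := m.+1%:R^-1.
have h0 : 0 < h by rewrite invr_gt0 ltr0n.
have mh : m.+1%:R * h = 1 by rewrite divff // pnatr_eq0.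
have [mu muE] := lebesgue_tuple_measure R n.
have mcubes (A : set {ffun E -> nat}) : finite_set A ->
    measurable (\bigcup_(b in A) cube h b).
  by move=> finA; apply: fin_bigcup_measurable => // b _;
    apply: measurable_half_open_box.
rewrite -!(measure_cubes muE h0) // [volume _](_ : _ = mu Q); last by rewrite muE.
apply/andP; split; apply: le_measure; rewrite ?inE.
- exact: mcubes.
- exact: measurable_polytope.
- move=> t [b hb /cubeP ht]; split=> [e|I idI].
    rewrite ffunE; have /andP[+ _] := ht e; apply: le_trans.
    by rewrite mulr_ge0 // ltW.
  (* Passing to the upper corner adds one per element, from [m * #|I|] to [m.+1 * #|I|], and [h]
     scales this to [#|I|]. *)
  apply: (@le_trans _ _ (\sum_(e in I) (b e).+1%:R * h)).
    by apply: ler_sum => e _; rewrite ffunE; have /andP[_ /ltW] := ht e.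
  have -> : #|I|%:R = (m.+1 * #|I|)%:R * h by rewrite natrM mulrAC mh mul1r.
  rewrite -mulr_suml -natr_sum; apply: ler_wpM2r; first exact: ltW.
  rewrite ler_nat.
  under eq_bigr do rewrite -addn1.
  by rewrite big_split /= sum1_card mulSn addnC leq_add2l hb.
- exact: measurable_polytope.
- exact: mcubes.
move=> t [t0 tI].
have t0' e : 0 <= tnth t (enum_rank e) / h.
  by have := t0 e; rewrite ffunE => ?; rewrite divr_ge0 // ltW.
exists [ffun e => Num.truncn (tnth t (enum_rank e) / h)].
  move=> I idI; rewrite -(ler_nat R) natr_sum natrM.
  apply: (@le_trans _ _ (\sum_(e in I) m.+1%:R * point t e)).
    apply: ler_sum => e _; rewrite !ffunE.
    rewrite (le_trans (y := tnth t (enum_rank e) / h)) ?truncn_le //.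
    by rewrite /h invrK mulrC.
  by rewrite -mulr_sumr ler_wpM2l // tI.
apply/cubeP => e; rewrite ffunE -ler_pdivlMr // -ltr_pdivrMr //.
exact: truncn_itv.
Qed.

End PolytopeVolume.

(** * The Ehrhart and zeta polynomials and the normalized volume *)

Section EhrhartPolynomial.
Variables (R : realType) (E : finType) (tau : rel E).
Hypotheses (tau_refl : reflexive tau) (tau_trans : transitive tau).

Let Q := preorder_polytope R tau.
Let Pd := preorder_points R (dual_rel tau).

Definition ehrhart_sum : {poly rat} :=
  \sum_(a <- fset_set Pd)
     \prod_(e : E) binomp ('X + ((`|a e|%N)%:R)%:P - 1) `|a e|%N.

Lemma finite_ideal_bounded (tau' : rel E) m :
  reflexive tau' -> transitive tau' -> finite_set [set b | ideal_bounded tau' m b].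
Proof.
move=> tr tt; apply: sub_finite_set (finite_hall_vector (@comparable_pair E tau' m)).
by move=> b; apply ideal_bounded_hall.
Qed.

Lemma finite_dual_points : finite_set Pd.
Proof.
rewrite /Pd preorder_pointsE; apply: finite_image; apply: finite_ideal_bounded.
  by move=> x; apply: tau_refl.
by move=> x y z xy yz; apply: tau_trans yz xy.
Qed.

Lemma mem_dual_points a : (a \in fset_set Pd) <->
  exists2 b, ideal_bounded (dual_rel tau) 1 b & a = int_point b.
Proof.
rewrite in_fset_set; last exact: finite_dual_points.
rewrite inE /Pd preorder_pointsE; split=> [[b hb <-]|[b hb ->]]; last by exists b.
by exists b.
Qed.

(** These arrays count both the lattice points of the [m]-th dilate and the multichains of length
    [m], so one evaluation serves both polynomials. *)
Lemma ncard_dual_row_sum m :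
  (ncard [set c | ideal_bounded (dual_rel tau) 1 (@row_sum E m c)])%:R =
  ehrhart_sum.[m%:R].
Proof.
rewrite (ncard_row_sum m (fset_uniq _) mem_dual_points) natr_sum horner_sum.
apply: eq_bigr => a _; rewrite natr_prod horner_prod.
by apply: eq_bigr => e _; rewrite binomp_weak_compositions.
Qed.

Lemma is_ehrhart_poly_sum : is_ehrhart_poly Q ehrhart_sum.
Proof. by move=> m; rewrite -ncard_dual_row_sum ncard_lattice_points. Qed.

Lemma ehrhart_polyE : ehrhart_poly Q = ehrhart_sum.
Proof.
apply: is_ehrhart_poly_unique is_ehrhart_poly_sum.
by apply: (@xgetPex _ _ [set p | is_ehrhart_poly Q p]); exists ehrhart_sum;
  apply: is_ehrhart_poly_sum.
Qed.

Lemma is_zeta_poly_sum : is_zeta_poly cw_le Pd (ehrhart_sum \Po ('X - 1)).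
Proof.
move=> m; rewrite ncard_multichains // ncard_dual_row_sum horner_comp.
by rewrite !hornerE -natr1 addrK.
Qed.

Lemma zeta_polyE : zeta_poly cw_le Pd = ehrhart_sum \Po ('X - 1).
Proof.
apply: is_zeta_poly_unique is_zeta_poly_sum.
apply: (@xgetPex _ _ [set p | is_zeta_poly cw_le Pd p]).
by exists (ehrhart_sum \Po ('X - 1)); apply: is_zeta_poly_sum.
Qed.

(** At [m = 1] every factor is 1, so the sum just counts the dual points. *)
Lemma ncard_lattice_points_dual :
  ncard (lattice_points Q) = ncard (lattice_points (preorder_polytope R (dual_rel tau))).
Proof.
have -> : lattice_points Q = lattice_points (dilate 1%:R Q).
  by rewrite lattice_points_dilate; apply: preorder_pointsE.
rewrite ncard_lattice_points // (ncard_row_sum 1 (fset_uniq _) mem_dual_points).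
rewrite /ncard -sum1_size; apply: eq_bigr => a _.
by rewrite big1 // => e _; rewrite /weak_compositions add0n binn.
Qed.

Lemma sum_ideal_bounded b : ideal_bounded (dual_rel tau) 1 b ->
  (\sum_e b e <= #|E|)%N.
Proof.
move=> /(_ _ (order_idealT (dual_rel tau))); rewrite mul1n cardsT.
by rewrite (eq_bigl xpredT) // => e; rewrite inE.
Qed.

Lemma prod_binomp_int_point (b : {ffun E -> nat}) :
  \prod_e binomp ('X + ((`|int_point b e|%N)%:R)%:P - 1) `|int_point b e|%N =
  \prod_e binomp ('X + ((b e)%:R)%:P - 1) (b e).
Proof. by apply: eq_bigr => e _; rewrite ffunE. Qed.

Lemma size_ehrhart_sum : (size ehrhart_sum <= #|E|.+1)%N.
Proof.
rewrite /ehrhart_sum big_seq.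
apply: (big_ind (fun p : {poly rat} => (size p <= #|E|.+1)%N)).
- by rewrite size_poly0.
- by move=> p q sp sq; apply: leq_trans (size_polyD _ _) _; rewrite geq_max sp.
move=> a /mem_dual_points[b hb ->].
by rewrite prod_binomp_int_point size_prod_binomp ltnS sum_ideal_bounded.
Qed.

(** Only points of total [#|E|] reach this degree, and the factorial of [#|E|] over the product of
    the factorials of the coordinates is the number of words with that content. *)
Lemma coef_ehrhart_sum :
  (#|E|)`!%:R * ehrhart_sum`_#|E| = (#|ideal_word tau #|E| |)%:R.
Proof.
have -> : #|ideal_word tau #|E| | =
    (\sum_(a <- fset_set Pd) \sum_(w : #|E|.-tuple E) (int_point (word_content w) == a))%N.
  rewrite exchange_big -sum1_card big_mkcond /=; apply: eq_bigr => w _.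
  have -> : (w \in ideal_word tau #|E|) = (int_point (word_content w) \in fset_set Pd).
    apply/idP/idP => [/ideal_wordE hw|/mem_dual_points[b hb /int_point_inj wb]].
      by apply/mem_dual_points; exists (word_content w).
    by apply/ideal_wordE; rewrite wb.
  transitivity (count_mem (int_point (word_content w)) (fset_set Pd)).
    by rewrite count_uniq_mem ?fset_uniq //; case: (_ \in _).
  rewrite -sum1_count big_mkcond; apply: eq_bigr => a _.
  by rewrite /= eq_sym; case: eqP.
rewrite coef_sum mulr_sumr natr_sum; apply: eq_big_seq => a /mem_dual_points[b hb ->].
rewrite prod_binomp_int_point coef_prod_binomp ?sum_ideal_bounded //.
have -> : (\sum_(w : #|E|.-tuple E) (int_point (word_content w) == int_point b) =
    \sum_(w : #|E|.-tuple E) (word_content w == b))%N.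
  by apply: eq_bigr => w _; rewrite (inj_eq (@int_point_inj E)).
(* A content of another total belongs to no word of length [#|E|]. *)
have [bE|bE] := eqVneq; last first.
  rewrite mul0r mulr0 big1 // => w _; case: eqP => // wb; case/eqP: bE.
  rewrite -wb -[RHS](size_tuple w) -(count_predT w).
  have := sum_word_content w (finset.setTfor E).
  rewrite (eq_bigl xpredT) => [->|e]; last by rewrite inE.
  by apply: eq_count => e; rewrite /= inE.
rewrite mul1r -(multinomial_count bE) natrM -mulrA natr_prod -big_split /=.
rewrite [X in _ * X = _]big1 ?mulr1 // => e _.
by rewrite divff // fact_ratr_neq0.
Qed.

(** Both bounds on the volume are polynomial inequalities at all positive integers, and each
    compares the volume with the coefficient of degree [#|E|]. *)
Lemma volume_polytope :
  normalized_volume Q = ((#|ideal_word tau #|E| |)%:R)%:E.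
Proof.
pose n := #|E|; pose p : {poly R} := map_poly ratr ehrhart_sum.
have pE m : p.[m%:R] = (ncard [set b | ideal_bounded tau m b])%:R.
  rewrite /p -(ratr_nat R) horner_map /= -[_.[_]]ncard_dual_row_sum ratr_nat.
  rewrite -(ncard_lattice_points R) // lattice_points_dilate ncard_image_inj //.
    exact: int_point_inj.
  exact: finite_ideal_bounded.
have bnd m := volume_polytope_bounds R (finite_ideal_bounded m tau_refl tau_trans)
  (finite_ideal_bounded m.+1 tau_refl tau_trans).
have [v vE] : exists v : R, volume Q = v%:E.
  exists (fine (volume Q)); rewrite fineK // fin_numE.
  have /andP[lo up] := bnd 0%N; rewrite -/Q in lo up.
  by apply/andP; split; apply/eqP => e; rewrite e in lo up.
have sp : (size p <= n.+1)%N by rewrite size_map_poly size_ehrhart_sum.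
have mn m : 0 < m.+1%:R ^+ n :> R by rewrite exprn_gt0.
have lo : 0 <= v - p`_n.
  (* The lower bound with count at [m + 1] uses cubes of side [1 / (m + 2)], hence a power of
     ['X + 1]. *)
  pose q : {poly R} := v *: ('X - (-1)%:P) ^+ n - p.
  have sX : size (('X - (-1)%:P) ^+ n : {poly R}) = n.+1 by rewrite size_exp_XsubC.
  have cX : (('X - (-1)%:P) ^+ n : {poly R})`_n = 1.
    have /monicP : ('X - (-1)%:P : {poly R}) ^+ n \is monic.
      by rewrite monic_exp // monicXsubC.
    by rewrite lead_coefE sX.
  have -> : v - p`_n = q`_n by rewrite coefB coefZ cX mulr1.
  apply: coef_ge0 => [|m].
    apply: leq_trans (size_polyD _ _) _; rewrite geq_max size_polyN sp andbT.
    by apply: leq_trans (size_scale_leq _ _) _; rewrite sX.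
  rewrite !hornerE pE opprK natr1 subr_ge0.
  have /andP[+ _] := bnd m.+1; rewrite -/Q vE lee_fin.
  by rewrite exprVn ler_pdivrMr.
have up : 0 <= p`_n - v.
  (* In the upper bound the count at [m + 1] goes with the side [1 / (m + 1)], so there is no
     shift. *)
  pose q : {poly R} := p - v *: 'X^n.
  have -> : p`_n - v = q`_n by rewrite coefB coefZ coefXn eqxx mulr1.
  apply: coef_ge0 => [|m].
    apply: leq_trans (size_polyD _ _) _; rewrite geq_max size_polyN sp.
    by apply: leq_trans (size_scale_leq _ _) _; rewrite size_polyXn.
  rewrite !hornerE pE subr_ge0.
  have /andP[_] := bnd m; rewrite -/Q vE lee_fin.
  by rewrite exprVn ler_pdivlMr.
have vp : v = p`_n.
  by apply/eqP; rewrite eq_le -subr_ge0 up -subr_ge0 lo.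
rewrite /normalized_volume vE vp -EFinM coef_map; congr EFin.
by rewrite -(ratr_nat R) -rmorphM /= coef_ehrhart_sum ratr_nat.
Qed.

End EhrhartPolynomial.

Theorem theorem1p5 (R : realType) (n : nat) (E : finType) (cardE : #|E| = n)
    (tau : rel E) (tau_refl : reflexive tau) (tau_trans : transitive tau) :
  let Q := preorder_polytope R tau in
  let Qd := preorder_polytope R (dual_rel tau) in
  let Pd := preorder_points R (dual_rel tau) in
  (is_ehrhart_poly Q (ehrhart_poly Q) /\
   is_zeta_poly cw_le Pd (zeta_poly cw_le Pd)) /\
  ([/\ ehrhart_poly Q =
         \sum_(a <- fset_set Pd)
           \prod_(e : E) binomp ('X + ((`|a e|%N)%:R)%:P - 1) `|a e|%N,
       ncard (lattice_points Q) = ncard (lattice_points Qd) &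
       normalized_volume Q = ((#|ideal_word tau n|)%:R)%:E] /\
   ehrhart_poly Q = zeta_poly cw_le Pd \Po ('X + 1)).
Proof.
move=> Q Qd Pd; split; first split.
- rewrite ehrhart_polyE //; exact: is_ehrhart_poly_sum.
- rewrite zeta_polyE //; exact: is_zeta_poly_sum.
split.
  split.
  - exact: ehrhart_polyE.
  - exact: ncard_lattice_points_dual.
  - by rewrite -cardE; apply: volume_polytope.
rewrite ehrhart_polyE // zeta_polyE // -comp_polyA.
by rewrite comp_polyB comp_polyX comp_polyC addrK comp_polyXr.
Qed.
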